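(* Let $1<p<\infty$ and $p\le q\le\infty$. (a) For every $T>0$ there exists a constant $C>0$ such that for all $u\in L^p_\sigma(\mathbb{R}^d)$ and all $0\le s<t\le T$ $$\|V(t,s)u\|_{L^q(\mathbb{R}^d)}\le C(t-s)^{-\frac d2\left(\frac1p-\frac1q\right)}\|u\|_{L^p(\mathbb{R}^d)},$$ $$\|\nabla V(t,s)u\|_{L^q(\mathbb{R}^d)}\le C(t-s)^{-\frac d2\left(\frac1p-\frac1q\right)-\frac12}\|u\|_{L^p(\mathbb{R}^d)}.$$ (b) Assume in addition that $M(t)$ is skew-symmetric for all $t>0$. Then there exists a constant $C>0$ such that for all $u\in L^p_\sigma(\mathbb{R}^d)$ and all $0\le s<t<\infty$ $$\|V(t,s)u\|_{L^q(\mathbb{R}^d)}\le C(t-s)^{-\frac d2\left(\frac1p-\frac1q\right)}\|u\|_{L^p(\mathbb{R}^d)},$$ $$\|\nabla V(t,s)u\|_{L^q(\mathbb{R}^d)}\le C(t-s)^{-\frac d2\left(\frac1p-\frac1q\right)-\frac12}\|u\|_{L^p(\mathbb{R}^d)}.$$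
   Context: Standing assumptions: $M:[0,\infty)\to\mathbb{R}^{d\times d}$ and $f:[0,\infty)\to\mathbb{R}^d$ are continuous, and $M(t)M(s)=M(s)M(t)$ for all $t,s>0$. For $t,s\ge 0$ put $U(t,s)=\exp\big(\int_s^t M(\tau)\,d\tau\big)$, and for $0\le s<t$ put $$g(t,s)=\int_s^t U(r,s)f(r)\,dr,\qquad Q_{t,s}=\int_s^t U(r,s)U^*(r,s)\,dr .$$ $L^p_\sigma(\mathbb{R}^d)$ is the space of all solenoidal (divergence-free) vector fields in $L^p(\mathbb{R}^d)^d$, with the $L^p$ norm. For $u\in L^p_\sigma(\mathbb{R}^d)$ and $0\le s<t$, $$V(t,s)u(x)=\frac{1}{(4\pi)^{d/2}(\det Q_{t,s})^{1/2}}\,U(s,t)\int_{\mathbb{R}^d}u\big(U(t,s)x+g(t,s)-y\big)\,e^{-\frac14\langle Q_{t,s}^{-1}y,y\rangle}\,dy,\qquad x\in\mathbb{R}^d ,$$ and $V(s,s)u=u$. $\nabla V(t,s)u$ denotes the $d\times d$ matrix of first-order partial derivatives. For $q=\infty$, $1/q=0$. *)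

(* Defs.v *)
From HB Require Import structures.
From mathcomp Require Import all_boot all_order all_algebra.
From mathcomp Require Import all_classical all_reals all_analysis.

Set Implicit Arguments.
Unset Strict Implicit.
Unset Printing Implicit Defensive.

Import Order.TTheory GRing.Theory Num.Theory.
Import numFieldNormedType.Exports.

Local Open Scope classical_set_scope.
Local Open Scope ring_scope.

(* Matrices carry the sigma-algebra generated by the entries, i.e. the Borel
   sigma-algebra of R^(m * n). *)

Definition mx_display : measure_display.
Proof. exact: default_measure_display. Qed.

Section measurable_mx.
Context {R : realType} {m n : nat}.

Definition measurable_entries : set (set 'M[R]_(m, n)) :=
  [set A | exists (i : 'I_m) (j : 'I_n), exists2 B : set R,
     measurable B & A = (fun X : 'M[R]_(m, n) => X i j) @^-1` B].

Definition measurable_mx : set (set 'M[R]_(m, n)) := <<s measurable_entries >>.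

Let mx_set0 : measurable_mx set0.
Proof. exact: sigma_algebra0. Qed.

Let mx_setC A : measurable_mx A -> measurable_mx (~` A).
Proof. exact: sigma_algebraC. Qed.

Let mx_bigcup (F : _^nat) :
  (forall i, measurable_mx (F i)) -> measurable_mx (\bigcup_i (F i)).
Proof. exact: sigma_algebra_bigcup. Qed.

HB.instance Definition _ := @isMeasurable.Build mx_display
  'M[R]_(m, n) measurable_mx mx_set0 mx_setC mx_bigcup.

Lemma measurable_entry (i : 'I_m) (j : 'I_n) :
  measurable_fun setT (fun X : 'M[R]_(m, n) => X i j).
Proof.
move=> _ B mB; rewrite setTI; apply: sub_sigma_algebra.
by exists i, j; exists B.
Qed.

Lemma measurable_fun_mxP d (T : measurableType d) (F : T -> 'M[R]_(m, n)) :
  measurable_fun setT F <->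
  forall i j, measurable_fun setT (fun x => F x i j).
Proof.
split=> [mF i j|mF].
  exact: (measurableT_comp (measurable_entry i j) mF).
apply: (measurability measurable_entries) => //.
move=> _ [_ [i [j [B mB ->]]] <-].
by rewrite -comp_preimage; exact: mF.
Qed.

End measurable_mx.

Section lebesgue_cV.
Context {R : realType}.
Local Notation RR := (measurableTypeR R).

Definition cV_cons n (z : RR * 'cV[R]_n) : 'cV[R]_n.+1 :=
  \col_i oapp (fun j => z.2 j 0) z.1 (unlift ord0 i).

Definition cV_uncons n (v : 'cV[R]_n.+1) : RR * 'cV[R]_n :=
  (v ord0 0, \col_j v (lift ord0 j) 0).

Lemma cV_consK n : cancel (@cV_cons n) (@cV_uncons n).
Proof.
move=> [x v]; rewrite /cV_uncons !mxE unlift_none/=; congr pair.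
by apply/colP => j; rewrite !mxE liftK.
Qed.

Lemma cV_unconsK n : cancel (@cV_uncons n) (@cV_cons n).
Proof.
by move=> v; apply/colP => i; rewrite mxE; case: unliftP => [j|] ->//=; rewrite mxE.
Qed.

Lemma measurable_cV_cons n : measurable_fun setT (@cV_cons n).
Proof.
apply/measurable_fun_mxP => i j.
under eq_fun do rewrite mxE.
case: unliftP => [k|] _ /=; last exact: measurable_fst.
exact: (measurableT_comp (measurable_entry k 0) measurable_snd).
Qed.

Lemma measurable_cV_uncons n : measurable_fun setT (@cV_uncons n).
Proof.
apply: measurable_fun_pair; first exact: measurable_entry.
apply/measurable_fun_mxP => i j.
by under eq_fun do rewrite mxE; exact: measurable_entry.
Qed.

Section succ.
Variables (n : nat) (mu : {sigma_finite_measure set 'cV[R]_n -> \bar R}).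

Definition lebesgue_cV_succ : set 'cV[R]_n.+1 -> \bar R :=
  pushforward (@lebesgue_measure R \x mu)%E (@cV_cons n).

Let mu' : {measure set 'cV[R]_n.+1 -> \bar R} :=
  measure_function_pushforward__canonical__measure_function_Measure
    (@lebesgue_measure R \x mu)%E (@measurable_cV_cons n).

HB.instance Definition _ := isMeasure.Build _ _ _ lebesgue_cV_succ
  (measure0 mu') (measure_ge0 mu') (@measure_semi_sigma_additive _ _ _ mu').

Let lebesgue_cV_succ_sigma_finite : sigma_finite setT lebesgue_cV_succ.
Proof.
have /sigma_finiteP[F [TF ndF Foo]] := sigma_finiteT (@lebesgue_measure R).
have /sigma_finiteP[G [TG ndG Goo]] := sigma_finiteT mu.
have mF k : measurable (F k) by case: (Foo k).
have mG k : measurable (G k) by case: (Goo k).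
exists (fun k => @cV_uncons n @^-1` (F k `*` G k)).
  rewrite -preimage_bigcup -[LHS](preimage_setT (@cV_uncons n)).
  congr (_ @^-1` _); rewrite -setXTT TF TG predeqE => -[x y]; split.
    move=> [/= [k _ Fkx] [l _ Gly]]; exists (maxn k l) => //; split => /=.
      by move: x Fkx; exact/subsetPset/ndF/leq_maxl.
    by move: y Gly; exact/subsetPset/ndG/leq_maxr.
  by move=> [k _ [? ?]]; split; exists k.
move=> k; split.
  rewrite -[X in measurable X]setTI; apply: measurable_cV_uncons => //.
  exact: measurableX.
rewrite /lebesgue_cV_succ /pushforward -comp_preimage.
rewrite (_ : _ \o _ = id) ?preimage_id; last first.
  by apply/funext => z /=; rewrite cV_consK.
rewrite product_measure1E// lte_mul_pinfty//.
- by rewrite ge0_fin_numE//; case: (Foo k).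
- by case: (Goo k).
Qed.

HB.instance Definition _ := Measure_isSigmaFinite.Build _ _ _ lebesgue_cV_succ
  lebesgue_cV_succ_sigma_finite.

End succ.

(* Lebesgue measure on R^n as an iterated product of the one-dimensional one;
   lebesgue_cV_box gives its value on boxes, which determines it. *)
Fixpoint lebesgue_cV n : {sigma_finite_measure set 'cV[R]_n -> \bar R} :=
  match n with
  | 0 => \d_(0 : 'cV[R]_0)
  | n'.+1 => lebesgue_cV_succ (lebesgue_cV n')
  end.

Lemma lebesgue_cV_box n (A : 'I_n -> set R) : (forall i, measurable (A i)) ->
  lebesgue_cV n [set v | forall i, A i (v i 0)] =
  (\prod_(i < n) (@lebesgue_measure R (A i)))%E.
Proof.
elim: n A => [|n IHn] A mA.
  rewrite big_ord0 /= diracE mem_set//; by case.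
have mA' : measurable [set v : 'cV[R]_n | forall i, A (lift ord0 i) (v i 0)].
  pose B i := (fun v : 'cV[R]_n => v i 0) @^-1` A (lift ord0 i).
  rewrite (_ : mkset _ = \bigcap_(i in [set: 'I_n]) B i).
    apply: fin_bigcap_measurable => // i _; rewrite -[B i]setTI.
    exact: measurable_entry.
  by apply/seteqP; split=> v Av i => [_|]; exact: Av.
rewrite big_ord_recl -IHn// -product_measure1E//; last exact: (mA ord0).
rewrite /= /lebesgue_cV_succ /pushforward; congr (product_measure1 _ _ _).
apply/seteqP; split=> -[x v] /= Av.
  split=> [|i]; first by have := Av ord0; rewrite mxE unlift_none.
  by have := Av (lift ord0 i); rewrite mxE liftK.
case: Av => Ax Av i; rewrite mxE.
by case: unliftP => [j|] -> /=; [exact: Av|exact: Ax].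
Qed.

End lebesgue_cV.
Arguments lebesgue_cV R n : clear implicits.

Section function_spaces.
Context {R : realType}.

(* Euclidean for n = 1, Frobenius in general; the library norm `|A| on matrices
   is the maximum of the entries. *)
Definition enorm m n (A : 'M[R]_(m, n)) : R :=
  Num.sqrt (\sum_i \sum_j A i j ^+ 2).

Definition dotv n (x y : 'cV[R]_n) : R := \sum_i x i 0 * y i 0.

Definition Lpnorm d m n (p : \bar R) (F : 'cV[R]_d -> 'M[R]_(m, n)) : \bar R :=
  Lnorm (lebesgue_cV R d) p (fun x => (enorm (F x))%:E).

Definition in_Lp d m n (p : \bar R) (F : 'cV[R]_d -> 'M[R]_(m, n)) : Prop :=
  measurable_fun setT F /\ (Lpnorm p F < +oo)%E.

Definition basisv d (j : 'I_d) : 'cV[R]_d := delta_mx j 0.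

Definition partial d (j : 'I_d) (phi : 'cV[R]_d -> R^o) : 'cV[R]_d -> R^o :=
  'D_(basisv j) phi.

(* C^oo: all iterated partial derivatives are Frechet differentiable, hence
   exist and are continuous. *)
Definition smooth d (phi : 'cV[R]_d -> R^o) : Prop :=
  forall (l : seq 'I_d) (x : 'cV[R]_d), differentiable (foldr (@partial d) phi l) x.

Definition test_function d (phi : 'cV[R]_d -> R^o) : Prop :=
  smooth phi /\ compact (closure [set x | phi x != 0]).

(* div u = 0 in the sense of distributions. *)
Definition divergence_free d (u : 'cV[R]_d -> 'cV[R]_d) : Prop :=
  forall phi : 'cV[R]_d -> R^o, test_function phi ->
  \int[lebesgue_cV R d]_x (\sum_(j < d) u x j 0 * partial j phi x) = 0.

Definition Lp_sigma d (p : \bar R) : set ('cV[R]_d -> 'cV[R]_d) :=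
  [set u | in_Lp p u /\ divergence_free u].

(* 'D_ is a default value where the limit does not exist, so an estimate on
   gradient v is meaningful only together with has_gradient v. *)
Definition has_gradient d (v : 'cV[R]_d -> 'cV[R]_d) : Prop :=
  forall x j, derivable v x (basisv j).

Definition gradient d (v : 'cV[R]_d -> 'cV[R]_d) (x : 'cV[R]_d) : 'M[R]_d :=
  \matrix_(i, j) ('D_(basisv j) v x) i 0.

End function_spaces.

Section evolution.
Context {R : realType} {d : nat}.

Definition integral_ab (a b : R) (h : R -> R) : R :=
  if a <= b then \int[lebesgue_measure]_(x in `[a, b]) h x
  else - \int[lebesgue_measure]_(x in `[b, a]) h x.

Definition mx_integral_ab m n (a b : R) (F : R -> 'M[R]_(m, n)) : 'M[R]_(m, n) :=
  \matrix_(i, j) integral_ab a b (fun r => F r i j).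

Definition expmx (A : 'M[R]_d) : 'M[R]_d :=
  limn (series (fun k => (k`!%:R)^-1 *: A ^+ k)).

Variables (M : R -> 'M[R]_d) (f : R -> 'cV[R]_d).

Definition evolU (t s : R) : 'M[R]_d := expmx (mx_integral_ab s t M).

Definition evolg (t s : R) : 'cV[R]_d :=
  mx_integral_ab s t (fun r => evolU r s *m f r).

Definition evolQ (t s : R) : 'M[R]_d :=
  mx_integral_ab s t (fun r => evolU r s *m (evolU r s)^T).

Definition evolV (t s : R) (u : 'cV[R]_d -> 'cV[R]_d) : 'cV[R]_d -> 'cV[R]_d :=
  if t == s then u else fun x =>
  ((4 * pi) `^ (d%:R / 2) * Num.sqrt (\det (evolQ t s)))^-1 *:
  (evolU s t *m
   \col_i \int[lebesgue_cV R d]_y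
     (u (evolU t s *m x + evolg t s - y) i 0 *
      expR (- 4^-1 * dotv (invmx (evolQ t s) *m y) y))).

End evolution.

(* Main.v *)
Require Import Defs.
From mathcomp Require Import all_boot all_order all_algebra.
From mathcomp Require Import all_classical all_reals all_analysis.
From mathcomp Require Import measurable_realfun ess_sup_inf perm ring lra.

(** The operator [evolV M f t s] is a Gaussian average. Let [U], [g], [Q] be
    [evolU M t s], [evolg M f t s] and [evolQ M t s]. After the substitution
    [z = U *m x + g - y], [evolV M f t s u x] is the integral of [u z] against
    a constant matrix times the Gaussian [expR (- 4^-1 * <Q^-1 y, y>)], taken
    at [y = U *m x + g - z] ([mehlerE]).

    Suppose that, for [r] between [s] and [t], the evolution matrices from [s]
    to [r] and from [r] to [s] have squared operator norm at most [L]. As the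
    integral of [U U^T], the matrix [Q] then lies between [(t - s) / L] and
    [(t - s) * L] as a quadratic form ([evolQ_ge], [evolQ_le]). Linear algebra
    for positive definite forms ([invmx_form_ge], [opbound_invmx],
    [inv_sqrt_det_le]) bounds [Q^-1] and [(det Q) ^ (- 1 / 2)]. So the kernel
    is at most a constant times [(t - s) ^ (- d / 2)] times the Gaussian
    [expR (- c * |U *m x + g - z| ^ 2)], with [c] of order [(t - s)^-1]. For
    the gradient, which is computed by differentiation under the integral,
    half of the Gaussian absorbs the linear factor and the price is one more
    [(t - s) ^ (- 1 / 2)] ([enorm_mehler_le], [enorm_gradient_mehler_le]).

    It remains to see that such an average maps [L^p] to [L^q]
    ([gaussian_smoothing]). By Hoelder's inequality, the [p]-th power of the
    average of [phi] is at most [G ^ (p - 1)] times the average of [phi ^ p],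
    where [G] is the mass of the Gaussian, of order [(t - s) ^ (d / 2)]. This
    is bounded pointwise, because the Gaussian is at most 1, and integrable in
    [x], by Tonelli's theorem and [integral_gauss_kernel_affine_le]. The case
    of general [q] interpolates between the two bounds. Collecting the powers
    of [t - s] gives [evolV_estimate], with constants depending on [L] only.

    Finally, a suitable [L] has to be found. On [[0, T]] the exponents of the
    evolution matrices are uniformly bounded, hence so are the matrices
    ([opbound_evolU]). For a skew-symmetric generator they are orthogonal, and
    [L = 1] serves for all times ([opbound_evolU_skew]). *)

Set Implicit Arguments.
Unset Strict Implicit.
Unset Printing Implicit Defensive.

Import Order.TTheory GRing.Theory Num.Theory.
Import numFieldNormedType.Exports.

Local Open Scope classical_set_scope.
Local Open Scope ring_scope.

(** * Euclidean forms and bounds for inverse matrices *)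

Lemma eq_ler (R : realType) (x y : R) : x = y -> x <= y.
Proof. by move=> ->. Qed.

Section euclidean.
Context {R : realType} {d : nat}.
Implicit Types (x y v w : 'cV[R]_d) (A B : 'M[R]_d).

Lemma dotvC x y : dotv x y = dotv y x.
Proof. by apply: eq_bigr => i _; rewrite mulrC. Qed.

Lemma dotvDl x y v : dotv (x + y) v = dotv x v + dotv y v.
Proof. by rewrite /dotv -big_split; apply: eq_bigr => i _; rewrite mxE mulrDl. Qed.

Lemma dotvZl k x v : dotv (k *: x) v = k * dotv x v.
Proof. by rewrite /dotv mulr_sumr; apply: eq_bigr => i _; rewrite mxE mulrA. Qed.

Lemma dotvDr x y v : dotv v (x + y) = dotv v x + dotv v y.
Proof. by rewrite dotvC dotvDl !(dotvC v). Qed.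

Lemma dotvZr k x v : dotv v (k *: x) = k * dotv v x.
Proof. by rewrite dotvC dotvZl dotvC. Qed.

Lemma dotvNl x v : dotv (- x) v = - dotv x v.
Proof. by rewrite -scaleN1r dotvZl mulN1r. Qed.

Lemma dotvNr x v : dotv v (- x) = - dotv v x.
Proof. by rewrite dotvC dotvNl dotvC. Qed.

Lemma dotv0l v : dotv 0 v = 0.
Proof. by rewrite -(scale0r 0) dotvZl mul0r. Qed.

Lemma dotvv_ge0 x : 0 <= dotv x x.
Proof. by apply: sumr_ge0 => i _; rewrite -expr2 sqr_ge0. Qed.

Lemma dotvv_eq0 x : dotv x x = 0 -> x = 0.
Proof.
move=> /eqP; rewrite psumr_eq0 => [/allP x0|i _]; last by rewrite -expr2 sqr_ge0.
apply/colP => i; have /= := x0 i; rewrite mem_index_enum => /(_ isT).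
by rewrite -expr2 sqrf_eq0 => /eqP ->; rewrite mxE.
Qed.

Lemma sqr_entry_le_dotv x i : x i 0 ^+ 2 <= dotv x x.
Proof.
rewrite /dotv (bigD1 i)//= -expr2 lerDl.
by apply: sumr_ge0 => j _; rewrite -expr2 sqr_ge0.
Qed.

Lemma dotv_mull A x y : dotv (A *m x) y = dotv x (A^T *m y).
Proof.
rewrite /dotv; under eq_bigr do rewrite mxE mulr_suml.
rewrite exchange_big; apply: eq_bigr => j _; rewrite mxE mulr_sumr.
by apply: eq_bigr => i _; rewrite mxE; ring.
Qed.

(** The form is a quadratic polynomial along a line, and a nonnegative
    polynomial has a nonpositive discriminant. *)
Lemma psd_cauchy_schwarz A x y : A^T = A -> (forall v, 0 <= dotv (A *m v) v) ->
  dotv (A *m x) y ^+ 2 <= dotv (A *m x) x * dotv (A *m y) y.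
Proof.
move=> symA psdA.
set a := dotv (A *m x) x; set b := dotv (A *m x) y; set c := dotv (A *m y) y.
have b' : dotv (A *m y) x = b by rewrite dotv_mull symA dotvC.
have q k l : 0 <= k ^+ 2 * a + 2 * (k * l) * b + l ^+ 2 * c.
  have := psdA (k *: x + l *: y).
  rewrite mulmxDr -!scalemxAr !(dotvDl, dotvDr, dotvZl, dotvZr) b' -/a -/b -/c.
  by move=> /le_trans; apply; apply: eq_ler; ring.
have [a0|a0] := eqVneq a 0.
  have [b0|b0] := eqVneq b 0; first by rewrite b0 a0 expr0n mul0r.
  (* The polynomial is now affine, and equals -1 at this point. *)
  have := q (- (c + 1) / (2 * b)) 1; rewrite a0 !mulr0 !add0r mulr1 expr1n mul1r.
  rewrite (_ : 2 * _ * b = - (c + 1)); last by field.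
  by lra.
have a_gt0 : 0 < a by rewrite lt_neqAle eq_sym a0 psdA.
have := q (- b) a.
rewrite (_ : _ + _ = a * (a * c - b ^+ 2)); last by ring.
by rewrite pmulr_rge0// subr_ge0.
Qed.

Lemma cauchy_schwarz x y : dotv x y ^+ 2 <= dotv x x * dotv y y.
Proof.
have := @psd_cauchy_schwarz 1%:M x y; rewrite !mul1mx; apply.
  exact: trmx1.
by move=> v; rewrite mul1mx dotvv_ge0.
Qed.

(** [L] bounds the square of the operator norm, which keeps square roots out
    of the estimates. *)
Definition opbound A (L : R) := forall v, dotv (A *m v) (A *m v) <= L * dotv v v.

Lemma opbound_tr A L : 0 <= L -> opbound A L -> opbound A^T L.
Proof.
move=> L0 bA v; set w := A^T *m v.
have [w0|w0] := eqVneq (dotv w w) 0; first by rewrite w0 mulr_ge0 ?dotvv_ge0.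
have wgt0 : 0 < dotv w w by rewrite lt_neqAle eq_sym w0 dotvv_ge0.
rewrite -(ler_pM2l wgt0) -expr2.
rewrite {1}(_ : dotv w w = dotv (A *m w) v); last by rewrite dotv_mull.
apply: (le_trans (cauchy_schwarz _ _)).
by rewrite mulrA (mulrC _ L) ler_wpM2r ?dotvv_ge0.
Qed.

Lemma dotv_basisv (j : 'I_d) : dotv (basisv j) (basisv j) = 1 :> R.
Proof.
rewrite /dotv (bigD1 j)//= mxE !eqxx mulr1 big1 ?addr0// => k /negbTE kj.
by rewrite mxE kj mul0r.
Qed.

Lemma opbound_entry A L i j : 0 <= L -> opbound A L -> `|A i j| <= Num.sqrt L.
Proof.
move=> L0 bA; rewrite -sqrtr_sqr ler_wsqrtr//.
have := bA (basisv j); rewrite dotv_basisv mulr1; apply: le_trans.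
by have := sqr_entry_le_dotv (A *m basisv j) i; rewrite -colE mxE.
Qed.

(** This norm dominates the operator norm, and its powers dominate the entries
    of the powers of [A]: it controls the exponential series entry by entry. *)
Definition sumnorm A : R := \sum_i \sum_j `|A i j|.

Lemma sumnorm_ge0 A : 0 <= sumnorm A.
Proof. by apply: sumr_ge0 => i _; apply: sumr_ge0. Qed.

Lemma opbound_sumnorm A : opbound A (sumnorm A ^+ 2).
Proof.
move=> v.
have row_le i : (A *m v) i 0 ^+ 2 <= (\sum_j `|A i j|) ^+ 2 * dotv v v.
  have vE : dotv v v = Num.sqrt (dotv v v) ^+ 2 by rewrite sqr_sqrtr ?dotvv_ge0.
  rewrite vE -exprMn -real_normK ?num_real// lerXn2r ?nnegrE//.
    by rewrite mulr_ge0// ?sqrtr_ge0// sumr_ge0.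
  rewrite mxE (le_trans (ler_norm_sum _ _ _))// mulr_suml ler_sum// => j _.
  rewrite normrM ler_wpM2l// -sqrtr_sqr ler_wsqrtr// sqr_entry_le_dotv//.
rewrite /dotv.
have -> : \sum_i (A *m v) i 0 * (A *m v) i 0 = \sum_i (A *m v) i 0 ^+ 2.
  by apply: eq_bigr => i _; rewrite expr2.
apply: (le_trans (ler_sum _ (fun i _ => row_le i))).
rewrite -mulr_suml ler_wpM2r ?dotvv_ge0// /sumnorm.
have r0 i : 0 <= \sum_j `|A i j| by apply: sumr_ge0.
rewrite [leRHS]expr2 mulr_suml; apply: ler_sum => i _.
by rewrite expr2 ler_wpM2l// [leRHS](bigD1 i)//= lerDl sumr_ge0.
Qed.

Lemma opbound_le A L L' : L <= L' -> opbound A L -> opbound A L'.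
Proof. by move=> LL' bA v; rewrite (le_trans (bA v))// ler_wpM2r ?dotvv_ge0. Qed.

Lemma opbound_inv_ge A B L : A *m B = 1%:M -> opbound A L ->
  forall v, dotv v v <= L * dotv (B *m v) (B *m v).
Proof. by move=> AB bA v; have := bA (B *m v); rewrite mulmxA AB mul1mx. Qed.

Section inverse_form.
Variables (Q : 'M[R]_d) (l L : R).
Hypotheses (l_gt0 : 0 < l) (symQ : Q^T = Q)
  (Q_ge : forall v, l * dotv v v <= dotv (Q *m v) v)
  (Q_le : forall v, dotv (Q *m v) v <= L * dotv v v).

Lemma coercive_unitmx : Q \in unitmx.
Proof.
rewrite -row_free_unit; apply: inj_row_free => v vQ.
have Qv : Q *m v^T = 0 by rewrite -{1}symQ -trmx_mul vQ trmx0.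
have := Q_ge v^T; rewrite Qv dotv0l pmulr_rle0// => v0.
have /dotvv_eq0 vT0 : dotv v^T v^T = 0 by apply/eqP; rewrite eq_le v0 dotvv_ge0.
by rewrite -[v]trmxK vT0 trmx0.
Qed.

Let Qinv_mul y : Q *m (invmx Q *m y) = y.
Proof. by rewrite mulmxA mulmxV ?mul1mx// coercive_unitmx. Qed.

Lemma invmx_sym : (invmx Q)^T = invmx Q.
Proof. by rewrite trmx_inv symQ. Qed.

(** Cauchy-Schwarz for the form of [Q], applied to [invmx Q *m y] and [y],
    bounds [dotv y y ^+ 2] by [dotv (invmx Q *m y) y * dotv (Q *m y) y]. *)
Lemma invmx_form_ge y : dotv y y <= L * dotv (invmx Q *m y) y.
Proof.
set w := invmx Q *m y; have Qw : Q *m w = y by exact: Qinv_mul.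
have psd v : 0 <= dotv (Q *m v) v.
  by rewrite (le_trans _ (Q_ge v))// mulr_ge0 ?dotvv_ge0// ltW.
have := psd_cauchy_schwarz w y symQ psd; rewrite Qw => cs.
have [y0|y0] := eqVneq (dotv y y) 0.
  by rewrite (dotvv_eq0 y0) dotvC !dotv0l mulr0.
have ygt0 : 0 < dotv y y by rewrite lt_neqAle eq_sym y0 dotvv_ge0.
rewrite -(ler_pM2l ygt0) -expr2 (le_trans cs)//.
have := Q_le y; rewrite (dotvC w y) => /(ler_wpM2l (_ : 0 <= dotv y w)).
by rewrite -Qw psd => /(_ isT) /le_trans; apply; apply: eq_ler; ring.
Qed.

Lemma opbound_invmx : opbound (invmx Q) (l ^- 2).
Proof.
move=> y; set w := invmx Q *m y; have Qw : Q *m w = y by exact: Qinv_mul.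
have h1 := Q_ge w; have h2 := cauchy_schwarz (Q *m w) w; rewrite Qw in h1 h2.
have [w0|w0] := eqVneq (dotv w w) 0.
  by rewrite w0 mulr_ge0 ?dotvv_ge0// invr_ge0 exprn_ge0// ltW.
have wgt0 : 0 < dotv w w by rewrite lt_neqAle eq_sym w0 dotvv_ge0.
rewrite mulrC ler_pdivlMr ?exprn_gt0// -(ler_pM2r wgt0).
apply: le_trans h2.
rewrite (_ : _ * _ * _ = (l * dotv w w) ^+ 2); last by ring.
have lw0 : 0 <= l * dotv w w by rewrite mulr_ge0 ?dotvv_ge0// ltW.
by rewrite lerXn2r ?nnegrE// (le_trans lw0).
Qed.

(** The Leibniz formula applied to the inverse, whose entries are at most
    [l^-1]: this replaces the spectral bound [l ^ d <= det Q]. *)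
Lemma det_invmx_le : `|\det (invmx Q)| <= d`!%:R * l ^- d.
Proof.
have entry i j : `|invmx Q i j| <= l^-1.
  rewrite -[leRHS]ger0_norm ?invr_ge0 ?(ltW l_gt0)// -(sqrtr_sqr l^-1) exprVn.
  by apply: opbound_entry opbound_invmx; rewrite invr_ge0 exprn_ge0// ltW.
rewrite /determinant (le_trans (ler_norm_sum _ _ _))//.
apply: (@le_trans _ _ (\sum_(s : 'S_d) l ^- d)); last first.
  by rewrite sumr_const card_Sn mulr_natl.
apply: ler_sum => s _; rewrite normrM normrX normrN normr1 expr1n mul1r.
  rewrite normr_prod (_ : l ^- d = \prod_(i < d) l^-1); last first.
    by rewrite prodr_const card_ord exprVn.
  by apply: ler_prod => i _; rewrite normr_ge0/= entry.
Qed.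

Lemma inv_sqrt_det_le :
  (Num.sqrt (\det Q))^-1 <= Num.sqrt (d`!%:R * l ^- d).
Proof.
(* When det Q <= 0 the left-hand side is 0, by the conventions on Num.sqrt
   and inverses. *)
have [dQ|dQ] := leP (\det Q) 0.
  by rewrite (ler0_sqrtr dQ) invr0 sqrtr_ge0.
rewrite -sqrtrV ?(ltW dQ)// -det_inv ler_wsqrtr//.
exact: le_trans (ler_norm _) det_invmx_le.
Qed.

End inverse_form.

End euclidean.

(** * The matrix exponential *)

Section exponential.
Context {R : realType} {d : nat}.
Implicit Types (A B : 'M[R]_d).

Lemma sum_triangle (F : nat -> nat -> R) n :
  \sum_(i < n) \sum_(j < n - i) F i j =
  \sum_(k < n) \sum_(i < k.+1) F i (k - i)%N.
Proof.
elim: n => [|n IHn]; first by rewrite !big_ord0.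
rewrite [RHS]big_ord_recr/= -IHn big_ord_recr/= subSn// subnn big_ord1.
rewrite big_ord_recr/= subnn addrA; congr (_ + _).
rewrite -big_split/=; apply: eq_bigr => i _.
by rewrite subSn ?big_ord_recr// ltnW.
Qed.

(** Along each diagonal [i + j = k] the factor [m k] is constant, and the
    remaining sum is the binomial expansion. *)
Lemma sum_triangle_exp (x y : R) (m : nat -> R) n :
  \sum_(i < n) \sum_(j < n - i)
    (x ^+ i / i`!%:R) * (y ^+ j / j`!%:R) * m (i + j)%N =
  \sum_(k < n) ((x + y) ^+ k / k`!%:R) * m k.
Proof.
rewrite (sum_triangle (fun i j =>
  (x ^+ i / i`!%:R) * (y ^+ j / j`!%:R) * m (i + j)%N)).
apply: eq_bigr => k _; rewrite addrC exprDn mulr_suml mulr_suml.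
apply: eq_bigr => i _; have ik : (i <= k)%N by rewrite -ltnS.
rewrite subnKC//; congr (_ * _).
have := bin_fact ik => /(congr1 (fun n => n%:R : R)); rewrite !natrM => binE.
rewrite -mulr_natr -binE; field.
rewrite !pnatr_eq0 -!lt0n !fact_gt0/=.
by rewrite bin_gt0 ik.
Qed.

Lemma square_sub_triangle_le (G H : nat -> nat -> R) n :
  (forall i j, `|G i j| <= H i j) ->
  `|\sum_(i < n) \sum_(j < n) G i j - \sum_(i < n) \sum_(j < n - i) G i j| <=
  \sum_(i < n) \sum_(j < n) H i j - \sum_(i < n) \sum_(j < n - i) H i j.
Proof.
move=> GH.
have split_row (K : nat -> nat -> R) : \sum_(i < n) \sum_(j < n) K i j -
    \sum_(i < n) \sum_(j < n - i) K i j =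
    \sum_(i < n) \sum_(n - i <= j < n) K i j.
  rewrite -sumrB; apply: eq_bigr => i _.
  rewrite -(big_mkord xpredT (K i)) -(big_mkord xpredT (K i)).
  by rewrite (@big_cat_nat _ _ _ (n - i)%N) ?leq_subr//= addrAC subrr add0r.
rewrite !split_row (le_trans (ler_norm_sum _ _ _))// ler_sum// => i _.
by rewrite (le_trans (ler_norm_sum _ _ _))// ler_sum.
Qed.

Lemma sumnorm_row A i : \sum_j `|A i j| <= sumnorm A.
Proof.
by rewrite /sumnorm [leRHS](bigD1 i)//= lerDl sumr_ge0// => k _; rewrite sumr_ge0.
Qed.

Lemma sumnormN A : sumnorm (- A) = sumnorm A.
Proof.
by apply: eq_bigr => i _; apply: eq_bigr => j _; rewrite mxE normrN.
Qed.

Lemma expr_entry_le A k i j : `|(A ^+ k) i j| <= sumnorm A ^+ k.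
Proof.
elim: k i j => [|k IHk] i j.
  by rewrite !expr0 mxE; case: (i == j); rewrite ?normr1 ?normr0.
rewrite !exprS mxE (le_trans (ler_norm_sum _ _ _))//.
apply: (@le_trans _ _ (\sum_l `|A i l| * sumnorm A ^+ k)).
  by apply: ler_sum => l _; rewrite normrM ler_wpM2l.
by rewrite -mulr_suml ler_wpM2r ?exprn_ge0 ?sumnorm_ge0// sumnorm_row.
Qed.

Lemma expr_oppmx A k : (- A) ^+ k = (-1) ^+ k *: A ^+ k.
Proof.
elim: k => [|k IHk]; first by rewrite !expr0 scale1r.
rewrite !exprS IHk mulN1r mulNr scaleNr; congr (- _).
exact: (esym (scalemxAr _ _ _)).
Qed.

Definition expmx_term A i j k : R := (A ^+ k) i j / k`!%:R.

Lemma series_expmxE A n i j :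
  series (fun k => (k`!%:R)^-1 *: A ^+ k) n i j = series (expmx_term A i j) n.
Proof.
rewrite !seriesEord summxE; apply: eq_bigr => k _.
by rewrite mxE mulrC.
Qed.

Lemma expmx_term_le A i j k : `|expmx_term A i j k| <= exp_coeff (sumnorm A) k.
Proof.
rewrite /expmx_term /exp_coeff/= normrM (@ger0_norm _ (_ ^-1))//.
by rewrite ler_wpM2r// expr_entry_le.
Qed.

Lemma is_cvg_normed_expmx_term A i j : cvgn [normed series (expmx_term A i j)].
Proof.
apply: (series_le_cvg _ _ _ (is_cvg_series_exp_coeff (sumnorm A))) => n.
- exact: normr_ge0.
- by rewrite /exp_coeff/= divr_ge0// exprn_ge0// sumnorm_ge0.
- exact: expmx_term_le.
Qed.

Lemma is_cvg_expmx_term A i j : cvgn (series (expmx_term A i j)).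
Proof. exact/normed_cvg/is_cvg_normed_expmx_term. Qed.

Lemma cvg_mx_entry T (FF : set_system T) {FFF : Filter FF} m n
    (F : T -> 'M[R]_(m, n)) (l : 'M[R]_(m, n)) :
  (forall i j, F k i j @[k --> FF] --> l i j) -> F k @[k --> FF] --> l.
Proof.
move=> Fl; apply/cvgrPdist_le => e e0; near=> k.
rewrite /Num.Def.normr/= mx_normrE (bigmax_le _ (ltW e0))//= => i _.
rewrite !mxE/=; move: i; near: k; apply: filter_forall => /= i.
exact: (cvgrPdist_le _ _).1 (Fl i.1 i.2) _ e0.
Unshelve. all: by end_near. Qed.

Lemma expmxE A i j : expmx A i j = limn (series (expmx_term A i j)).
Proof.
rewrite /expmx (_ : limn _ = \matrix_(i, j) limn (series (expmx_term A i j))).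
  by rewrite mxE.
apply/cvg_lim => //; apply: cvg_mx_entry => {}i {}j.
rewrite mxE; under eq_fun do rewrite series_expmxE.
exact: is_cvg_expmx_term.
Qed.

Lemma expmx_cvg A i j : series (expmx_term A i j) n @[n --> \oo] --> expmx A i j.
Proof. rewrite expmxE; exact: is_cvg_expmx_term. Qed.

Lemma expmx_entry_le A i j : `|expmx A i j| <= expR (sumnorm A).
Proof.
rewrite expmxE; have cA := @is_cvg_normed_expmx_term A i j.
apply: (le_trans (lim_series_norm cA)).
apply: lim_series_le.
- exact: is_cvg_normed_expmx_term.
- exact: is_cvg_series_exp_coeff.
- by move=> n; exact: expmx_term_le.
Qed.

Lemma sumnorm_expmx A : sumnorm (expmx A) <= (d ^ 2)%:R * expR (sumnorm A).
Proof.
apply: (@le_trans _ _ (\sum_(i < d) \sum_(j < d) expR (sumnorm A))).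
  by apply: ler_sum => i _; apply: ler_sum => j _; exact: expmx_entry_le.
by rewrite !sumr_const !card_ord -mulrnA mulr_natl.
Qed.

Lemma trmx_exp A k : (A ^+ k)^T = A^T ^+ k.
Proof.
elim: k => [|k IHk]; first by rewrite !expr0 trmx1.
by rewrite exprS exprSr -IHk; exact: trmx_mul.
Qed.

Lemma trmx_expmx A : (expmx A)^T = expmx A^T.
Proof.
apply/matrixP => i j; rewrite mxE !expmxE; congr (limn (series _)).
by apply/funext => k; rewrite /expmx_term -trmx_exp mxE.
Qed.

(** The Cauchy product: the terms of [exp A * exp (- A)] outside the triangle
    [i + j < n] are dominated by those of [exp a * exp a], which tend to
    [expR a ^+ 2 - expR (2 * a) = 0]. *)
Lemma expmx_mulN A : expmx A *m expmx (- A) = 1%:M.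
Proof.
set a := sumnorm A.
apply/matrixP => p q.
pose S n : R := \sum_l series (expmx_term A p l) n * series (expmx_term (- A) l q) n.
have S_cvg : S n @[n --> \oo] --> (expmx A *m expmx (- A)) p q.
  rewrite mxE; apply: cvg_big => //= [|l _].
    by move=> x; exact: add_continuous.
  by apply: cvgM; exact: expmx_cvg.
have SE n : S n = \sum_(i < n) \sum_(j < n)
    (1 ^+ i / i`!%:R) * ((-1) ^+ j / j`!%:R) * (A ^+ (i + j)) p q.
  rewrite /S; under eq_bigr do rewrite !seriesEord/= mulr_suml.
  rewrite exchange_big; apply: eq_bigr => i _/=.
  under eq_bigr do rewrite mulr_sumr.
  rewrite exchange_big; apply: eq_bigr => j _/=.
  rewrite exprD mxE mulr_sumr; apply: eq_bigr => l _.
  rewrite /expmx_term expr1n.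
  by rewrite (_ : (- A) ^+ j = (-1) ^+ j *: A ^+ j) ?mxE; [ring|exact: expr_oppmx].
have bnd n : `|S n.+1 - (1%:M : 'M[R]_d) p q| <=
    series (exp_coeff a) n.+1 ^+ 2 - series (exp_coeff (2 * a)) n.+1.
  have -> : (1%:M : 'M[R]_d) p q = \sum_(i < n.+1) \sum_(j < n.+1 - i)
      (1 ^+ i / i`!%:R) * ((-1) ^+ j / j`!%:R) * (A ^+ (i + j)) p q.
    rewrite (sum_triangle_exp 1 (-1) (fun k => (A ^+ k) p q)) subrr.
    rewrite big_ord_recl/= expr0 fact0 divr1 mul1r big1 ?addr0// => i _.
    by rewrite expr0n/= !mul0r.
  pose G i j : R := (1 ^+ i / i`!%:R) * ((-1) ^+ j / j`!%:R) * (A ^+ (i + j)) p q.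
  pose H i j : R := (1 ^+ i / i`!%:R) * (1 ^+ j / j`!%:R) * a ^+ (i + j).
  have GH i j : `|G i j| <= H i j.
    rewrite !normrM !normrX normrN normr1 !normfV !normr_nat.
    by rewrite ler_wpM2l ?expr_entry_le// !mulr_ge0// ?exprn_ge0 ?invr_ge0.
  rewrite SE; apply: (le_trans (square_sub_triangle_le _ GH)); rewrite /H.
  rewrite (sum_triangle_exp 1 1 (fun k => a ^+ k)); apply: eq_ler.
  congr (_ - _).
    rewrite expr2 !seriesEord mulr_suml; apply: eq_bigr => i _.
    rewrite mulr_sumr; apply: eq_bigr => j _.
    by rewrite /exp_coeff/= !expr1n exprD; ring.
  rewrite !seriesEord; apply: eq_bigr => i _.
  by rewrite /exp_coeff/= exprMn (_ : 1 + 1 = 2)//; ring.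
apply/eqP; rewrite -subr_eq0 -normr_le0.
set D := _ - _.
have D_cvg : `|S n.+1 - (1%:M : 'M[R]_d) p q| @[n --> \oo] --> `|D|.
  apply: cvg_norm; apply: cvgB; last exact: cvg_cst.
  by move: S_cvg; rewrite -(cvg_shiftS S).
have b_cvg : series (exp_coeff a) n.+1 ^+ 2 - series (exp_coeff (2 * a)) n.+1
    @[n --> \oo] --> (0 : R).
  rewrite (_ : 0 = expR a * expR a - expR (2 * a)); last first.
    by rewrite -expRD (_ : 2 * a = a + a) ?subrr//; ring.
  apply: cvgB; last first.
    by rewrite (cvg_shiftS (series (exp_coeff (2 * a)))); exact: is_cvg_series_exp_coeff.
  under eq_fun do rewrite expr2.
  by apply: cvgM; rewrite (cvg_shiftS (series (exp_coeff a))); exact: is_cvg_series_exp_coeff.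
apply: (ler_cvg_to D_cvg b_cvg).
by apply: nearW => n; exact: bnd.
Qed.

End exponential.

(** * Lebesgue integration on column vectors *)

Section measurable_matrix_operations.
Context {R : realType} {disp : measure_display} {T : measurableType disp}.

Lemma measurable_mxD m n (F G : T -> 'M[R]_(m, n)) :
  measurable_fun setT F -> measurable_fun setT G ->
  measurable_fun setT (fun x => F x + G x).
Proof.
move=> /measurable_fun_mxP mF /measurable_fun_mxP mG.
apply/measurable_fun_mxP => i j; under eq_fun do rewrite mxE.
exact: measurable_funD.
Qed.

Lemma measurable_mxN m n (F : T -> 'M[R]_(m, n)) :
  measurable_fun setT F -> measurable_fun setT (fun x => - F x).
Proof.
move=> /measurable_fun_mxP mF.
apply/measurable_fun_mxP => i j; under eq_fun do rewrite mxE.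
exact: measurable_funN.
Qed.

Lemma measurable_mulmxl k m n (A : 'M[R]_(k, m)) (F : T -> 'M[R]_(m, n)) :
  measurable_fun setT F -> measurable_fun setT (fun x => A *m F x).
Proof.
move=> /measurable_fun_mxP mF.
apply/measurable_fun_mxP => i j; under eq_fun do rewrite mxE.
by apply: measurable_sum => l; exact: measurable_funM.
Qed.

Lemma measurable_dotv n (F G : T -> 'cV[R]_n) :
  measurable_fun setT F -> measurable_fun setT G ->
  measurable_fun setT (fun x => dotv (F x) (G x)).
Proof.
move=> /measurable_fun_mxP mF /measurable_fun_mxP mG.
by apply: measurable_sum => l; exact: measurable_funM.
Qed.

Lemma measurable_enorm m n (F : T -> 'M[R]_(m, n)) :
  measurable_fun setT F -> measurable_fun setT (fun x => enorm (F x)).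
Proof.
move=> /measurable_fun_mxP mF.
rewrite /enorm; apply: measurableT_comp; first
  exact: (continuous_measurable_fun (@sqrt_continuous R)).
by apply: measurable_sum => i; apply: measurable_sum => j; exact: measurable_funX.
Qed.

End measurable_matrix_operations.

Section lebesgue_cV_integral.
Context {R : realType}.
Local Notation mu := (@lebesgue_measure R).

Lemma lebesgue_measure_reflect (c : R) (A : set (measurableTypeR R)) :
  measurable A ->
  pushforward mu ((fun x => c - x) : _ -> measurableTypeR R) A = mu A.
Proof.
move=> mA.
have mc : measurable_fun setT ((fun x => c - x) : measurableTypeR R -> measurableTypeR R).
  exact: measurable_funB.
pose nu := measure_function_pushforward__canonical__measure_function_Measure mu mc.
apply/esym; apply: (@lebesgue_measure_unique _ nu) => //= _ [[a b]] _ <-.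
rewrite /nu/= /pushforward.
rewrite (_ : _ @^-1` _ = `[c - b, c - a[%classic); last first.
  by apply/seteqP; split=> x /=; rewrite !in_itv/= => /andP[? ?]; apply/andP; split; lra.
rewrite !lebesgue_measure_itv/= !lte_fin ltrD2l ltrN2.
by case: ifP => // _; rewrite -!EFinD; congr EFin; lra.
Qed.

Lemma ge0_integral_reflect (c : R) (h : measurableTypeR R -> \bar R) :
  measurable_fun setT h -> (forall x, 0 <= h x)%E ->
  (\int[mu]_x h (c - x)%R = \int[mu]_x h x)%E.
Proof.
move=> mh h0.
have mc : measurable_fun setT ((fun x => c - x) : measurableTypeR R -> measurableTypeR R).
  exact: measurable_funB.
rewrite -[LHS]/(\int[mu]_(x in
  ((fun x => c - x)%R : _ -> measurableTypeR R) @^-1` setT) (h \o (fun x => c - x)%R) x)%E.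
rewrite -ge0_integral_pushforward//.
by apply: eq_measure_integral => A mA _; exact: lebesgue_measure_reflect.
Qed.

Lemma ge0_integral_cV_succ n (h : 'cV[R]_n.+1 -> \bar R) :
  measurable_fun setT h -> (forall x, 0 <= h x)%E ->
  (\int[lebesgue_cV R n.+1]_y h y =
   \int[mu]_x \int[lebesgue_cV R n]_v h (cV_cons (x, v)))%E.
Proof.
move=> mh h0.
have mh' : measurable_fun setT (h \o @cV_cons R n).
  exact: (measurableT_comp mh (@measurable_cV_cons R n)).
rewrite -(fubini_tonelli1 (m1 := mu) (m2 := lebesgue_cV R n)
  (h \o @cV_cons R n)) => [|//|x]; last exact: h0.
exact: (@ge0_integral_pushforward _ _ _ _ _ _ (@measurable_cV_cons R n) _ setT h).
Qed.

(** Lebesgue measure on column vectors is built one coordinate at a time, so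
    the invariance under [y |-> c - y] follows from Tonelli's theorem and the
    one-dimensional case. *)
Lemma ge0_integral_cV_reflect n (c : 'cV[R]_n) (h : 'cV[R]_n -> \bar R) :
  measurable_fun setT h -> (forall x, 0 <= h x)%E ->
  (\int[lebesgue_cV R n]_y h (c - y)%R = \int[lebesgue_cV R n]_y h y)%E.
Proof.
elim: n c h => [|n IHn] c h mh h0.
  by apply: eq_integral => y _; congr h; apply/colP; case.
have mcons : measurable_fun setT (h \o @cV_cons R n).
  exact: (measurableT_comp mh (@measurable_cV_cons R n)).
have consB x v : c - cV_cons (x, v) =
    cV_cons ((c ord0 0 : measurableTypeR R) - x, (cV_uncons c).2 - v).
  apply/colP => i; rewrite !mxE; case: unliftP => [j|] -> //=.
  by rewrite !mxE.
rewrite ge0_integral_cV_succ//; last first.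
  apply: (measurableT_comp mh); apply: measurable_mxD => //.
  by apply: measurable_mxN; exact: measurable_id.
rewrite (ge0_integral_cV_succ mh h0).
pose H x := (\int[lebesgue_cV R n]_v h (cV_cons (x, v)))%E.
transitivity (\int[mu]_x H (c ord0 0 - x)%R)%E; last first.
  apply: ge0_integral_reflect => [|x]; last exact: integral_ge0.
  exact: (measurable_fun_fubini_tonelli_F (m2 := lebesgue_cV R n)
    (h \o @cV_cons R n) mcons (fun z => h0 _)).
apply: eq_integral => x _; rewrite /H.
under eq_integral do rewrite consB.
apply: (IHn _ (fun v => h (cV_cons (_, v)))) => //.
exact: (measurableT_comp mcons (measurable_pair1 _)).
Qed.

Lemma Rintegral_cV_reflect n (c : 'cV[R]_n) (h : 'cV[R]_n -> R) :
  measurable_fun setT h ->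
  \int[lebesgue_cV R n]_y h (c - y) = \int[lebesgue_cV R n]_y h y.
Proof.
move=> mh; rewrite /Rintegral; congr fine; rewrite [LHS]integralE [RHS]integralE.
have mEh : measurable_fun setT (fun y => (h y)%:E) by exact/measurable_EFinP.
congr (_ - _)%E.
- rewrite -[RHS](ge0_integral_cV_reflect c).
  + by apply: eq_integral => y _; rewrite !funeposE.
  + exact: measurable_funepos.
  + by move=> x; exact: funepos_ge0.
- rewrite -[RHS](ge0_integral_cV_reflect c).
  + by apply: eq_integral => y _; rewrite !funenegE.
  + exact: measurable_funeneg.
  + by move=> x; exact: funeneg_ge0.
Qed.

Lemma integral_gaussian (k m : R) : 0 < k ->
  (\int[mu]_x (expR (- k * (x - m) ^+ 2))%:E = (Num.sqrt (pi / k))%:E)%E.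
Proof.
move=> k0; set s := Num.sqrt ((2 * k)^-1).
have s2 : s ^+ 2 = (2 * k)^-1 by rewrite sqr_sqrtr// invr_ge0 mulr_ge0// ltW.
have s0 : s != 0 by rewrite gt_eqF// sqrtr_gt0 invr_gt0 mulr_gt0.
have peakE : normal_peak s = (Num.sqrt (pi / k))^-1.
  rewrite /normal_peak s2; congr (Num.sqrt _)^-1.
  by field; rewrite gt_eqF.
have p0 : 0 < Num.sqrt (pi / k) by rewrite sqrtr_gt0 divr_gt0 ?pi_gt0.
have pdfE x : normal_pdf m s x = (Num.sqrt (pi / k))^-1 * expR (- k * (x - m) ^+ 2).
  rewrite normal_pdfE// peakE /normal_fun s2; congr (_ * expR _).
  by field; rewrite gt_eqF.
have := integral_normal_pdf m s.
under eq_integral do rewrite pdfE EFinM.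
rewrite ge0_integralZl//=; first last.
  apply/measurable_EFinP; apply: measurableT_comp => //.
  by apply: measurable_funM => //; apply: measurable_funX; exact: measurable_funB.
move=> /(congr1 (fun z => (Num.sqrt (pi / k))%:E * z)%E).
by rewrite muleA -EFinM divff ?gt_eqF// mul1e mule1.
Qed.

Lemma measurable_gaussian n (k : R) (m : 'cV[R]_n) :
  measurable_fun setT (fun y : 'cV[R]_n => expR (- k * dotv (y - m) (y - m))).
Proof.
apply: measurableT_comp => //; apply: measurable_funM => //.
by apply: measurable_dotv; apply: measurable_mxD => //; exact: measurable_id.
Qed.

Lemma integral_cV_gaussian n (k : R) (m : 'cV[R]_n) : 0 < k ->
  (\int[lebesgue_cV R n]_y (expR (- k * dotv (y - m) (y - m)))%:E =
   (Num.sqrt (pi / k) ^+ n)%:E)%E.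
Proof.
move=> k0; elim: n m => [|n IHn] m.
  rewrite (integral_dirac (0 : 'cV[R]_0) measurableT)//=; last first.
    by apply/measurable_EFinP; exact: measurable_gaussian.
  rewrite diracT mul1e.
  by rewrite /dotv big_ord0 mulr0 expR0 expr0.
rewrite ge0_integral_cV_succ//; last first.
  by apply/measurable_EFinP; exact: measurable_gaussian.
set m' := (cV_uncons m).2.
have split_exp x v : expR (- k * dotv (cV_cons (x, v) - m) (cV_cons (x, v) - m)) =
    expR (- k * (x - m ord0 0) ^+ 2) * expR (- k * dotv (v - m') (v - m')).
  rewrite -expRD; congr expR; rewrite -mulrDr; congr (_ * _).
  rewrite /dotv big_ord_recl; congr (_ + _).
    by rewrite !mxE unlift_none expr2.
  by apply: eq_bigr => i _; rewrite !mxE liftK.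
transitivity (\int[mu]_x ((expR (- k * (x - m ord0 0) ^+ 2))%:E *
    (Num.sqrt (pi / k) ^+ n)%:E))%E.
  apply: eq_integral => x _; under eq_integral do rewrite split_exp EFinM.
  rewrite ge0_integralZl//= ?IHn//.
  by apply/measurable_EFinP; exact: measurable_gaussian.
rewrite ge0_integralZr//=; first last.
  apply/measurable_EFinP; apply: measurableT_comp => //.
  by apply: measurable_funM => //; apply: measurable_funX; exact: measurable_funB.
by rewrite integral_gaussian// -EFinM -exprS.
Qed.

End lebesgue_cV_integral.

(** * Smoothing by Gaussian kernels *)

Section gauss_kernel.
Context {R : realType} {d : nat}.
Local Notation mu := (lebesgue_cV R d).

Definition gauss_kernel (c : R) (w z : 'cV[R]_d) : R :=
  expR (- c * dotv (w - z) (w - z)).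

Lemma gauss_kernel_ge0 c w z : 0 <= gauss_kernel c w z.
Proof. exact: expR_ge0. Qed.

Lemma gauss_kernel_le1 c w z : 0 <= c -> gauss_kernel c w z <= 1.
Proof.
by move=> c0; rewrite -expR0 ler_expR mulNr oppr_le0 mulr_ge0 ?dotvv_ge0.
Qed.

Lemma measurable_gauss_kernel_comp disp (T : measurableType disp) c
    (F G : T -> 'cV[R]_d) :
  measurable_fun setT F -> measurable_fun setT G ->
  measurable_fun setT (fun x => gauss_kernel c (F x) (G x)).
Proof.
move=> mF mG; apply: measurableT_comp => //; apply: measurable_funM => //.
by apply: measurable_dotv; apply: measurable_mxD => //; exact: measurable_mxN.
Qed.

Lemma measurable_gauss_kernel c w : measurable_fun setT (gauss_kernel c w).
Proof. by apply: measurable_gauss_kernel_comp => //; exact: measurable_id. Qed.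

Definition gauss_mass (c : R) : R := Num.sqrt (pi / c) ^+ d.

Lemma gauss_mass_gt0 c : 0 < c -> 0 < gauss_mass c.
Proof. by move=> c0; rewrite exprn_gt0// sqrtr_gt0 divr_gt0// pi_gt0. Qed.

Lemma integral_gauss_kernel c w : 0 < c ->
  (\int[mu]_z (gauss_kernel c w z)%:E = (gauss_mass c)%:E)%E.
Proof.
move=> c0; rewrite -(integral_cV_gaussian w c0); apply: eq_integral => z _.
by rewrite /gauss_kernel -(opprB z w) dotvNl dotvNr opprK.
Qed.

(** A substitute for the linear change of variables: with [m] the preimage of
    [z] under [x |-> U *m x + g], the kernel is below a Gaussian centred at
    [m] whose width depends only on [c] and [L]. *)
Lemma integral_gauss_kernel_affine_le c L (U : 'M[R]_d) (g z : 'cV[R]_d) :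
  0 < c -> 0 < L -> U \in unitmx ->
  (forall v, dotv v v <= L * dotv (U *m v) (U *m v)) ->
  (\int[mu]_x (gauss_kernel c (U *m x + g) z)%:E <= (gauss_mass (c / L))%:E)%E.
Proof.
move=> c0 L0 uU UL; set m := invmx U *m (z - g).
have cL0 : 0 < c / L by rewrite divr_gt0.
rewrite /gauss_mass -(integral_cV_gaussian m cL0); apply: ge0_le_integral => //.
- by move=> x _; rewrite lee_fin expR_ge0.
- apply/measurable_EFinP; apply: measurable_gauss_kernel_comp => //.
  by apply: measurable_mxD => //; apply: measurable_mulmxl; exact: measurable_id.
- by apply/measurable_EFinP; exact: measurable_gaussian.
- move=> x _; rewrite lee_fin ler_expR !mulNr lerN2 -mulrA ler_wpM2l ?(ltW c0)//.
  rewrite mulrC ler_pdivrMr// mulrC (le_trans (UL _))//.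
  rewrite mulmxBr mulmxA mulmxV// mul1mx (_ : U *m x - (z - g) = U *m x + g - z)//.
  by rewrite opprB addrA.
Qed.

End gauss_kernel.
Arguments gauss_mass {R} d c.

Definition gauss_average (R : realType) d (c : R) (U : 'M[R]_d)
    (g : 'cV[R]_d) (phi : 'cV[R]_d -> R) (x : 'cV[R]_d) : \bar R :=
  (\int[lebesgue_cV R d]_z (phi z * gauss_kernel c (U *m x + g) z)%:E)%E.

Section gaussian_smoothing.
Context {R : realType} {d : nat}.
Local Notation mu := (lebesgue_cV R d).
Variables (c L : R) (U : 'M[R]_d) (g : 'cV[R]_d).
Hypotheses (c_gt0 : 0 < c) (L_gt0 : 0 < L) (U_unit : U \in unitmx)
  (U_ge : forall v, dotv v v <= L * dotv (U *m v) (U *m v)).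
Variables (p : R) (phi : 'cV[R]_d -> R).
Hypotheses (p_gt1 : 1 < p) (mphi : measurable_fun setT phi)
  (phi_ge0 : forall x, 0 <= phi x).

Let k x z := gauss_kernel c (U *m x + g) z.
Let G := gauss_mass d c.
Let p_gt0 : 0 < p. Proof. exact: lt_trans p_gt1. Qed.
Let p_neq0 : p != 0. Proof. by rewrite gt_eqF. Qed.

Let k_ge0 x z : 0 <= k x z. Proof. exact: gauss_kernel_ge0. Qed.
Let mk x : measurable_fun setT (k x). Proof. exact: measurable_gauss_kernel. Qed.
Let G_gt0 : 0 < G. Proof. exact: gauss_mass_gt0. Qed.

Let J x : \bar R := (\int[mu]_z (phi z `^ p * k x z)%:E)%E.
Let Ip : \bar R := (\int[mu]_z (phi z `^ p)%:E)%E.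

Let mphip : measurable_fun setT (fun z => phi z `^ p).
Proof. exact: (measurableT_comp (measurable_powR _) mphi). Qed.

Let PK (xz : 'cV[R]_d * 'cV[R]_d) : \bar R := (phi xz.2 `^ p * k xz.1 xz.2)%:E.

Let mPK : measurable_fun setT PK.
Proof.
apply/measurable_EFinP; apply: measurable_funM.
  exact: (measurableT_comp mphip measurable_snd).
apply: measurable_gauss_kernel_comp; last exact: measurable_snd.
by apply: measurable_mxD => //; apply: measurable_mulmxl; exact: measurable_fst.
Qed.

Let PK_ge0 xz : (0 <= PK xz)%E.
Proof. by rewrite lee_fin mulr_ge0// powR_ge0. Qed.

Let mJ : measurable_fun setT J.
Proof. exact: (measurable_fun_fubini_tonelli_F (m2 := mu) PK mPK PK_ge0). Qed.

Let J_ge0 x : (0 <= J x)%E.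
Proof. by apply: integral_ge0 => z _; rewrite lee_fin mulr_ge0// powR_ge0. Qed.

Let J_le x : (J x <= Ip)%E.
Proof.
apply: ge0_le_integral => //.
- by move=> z _; rewrite lee_fin mulr_ge0// powR_ge0.
- by apply/measurable_EFinP; exact: measurable_funM.
- exact/measurable_EFinP.
- move=> z _; rewrite lee_fin ler_piMr ?powR_ge0//.
  exact/gauss_kernel_le1/ltW.
Qed.

Let int_J : (\int[mu]_x J x <= (gauss_mass d (c / L))%:E * Ip)%E.
Proof.
rewrite [leLHS](fubini_tonelli (m1 := mu) (m2 := mu) PK mPK PK_ge0).
rewrite muleC -ge0_integralZr//; first last.
- by rewrite lee_fin ltW// gauss_mass_gt0// divr_gt0.
- by move=> z _; rewrite lee_fin powR_ge0.
- exact/measurable_EFinP.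
have mkx z : measurable_fun setT (fun x => k x z).
  apply: measurable_gauss_kernel_comp => //.
  by apply: measurable_mxD => //; apply: measurable_mulmxl; exact: measurable_id.
apply: ge0_le_integral.
- exact: measurableT.
- by move=> z _; apply: integral_ge0 => x _; exact: PK_ge0.
- exact: (measurable_fun_fubini_tonelli_G (m1 := mu) PK mPK PK_ge0).
- by apply: emeasurable_funM; [exact/measurable_EFinP|exact: measurable_cst].
- move=> z _; rewrite /PK/=; under eq_integral do rewrite EFinM.
  rewrite ge0_integralZl; first last.
  + by rewrite lee_fin powR_ge0.
  + by move=> x _; rewrite lee_fin.
  + exact/measurable_EFinP.
  + exact: measurableT.
  apply: lee_wpmul2l; first by rewrite lee_fin powR_ge0.
  exact: integral_gauss_kernel_affine_le.
Qed.

(** Hoelder's inequality for the finite measure with density [k x]. *)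
Let smoothing_hoelder x :
  (gauss_average c U g phi x <= J x `^ p^-1 * (G `^ (1 - p^-1))%:E)%E.
Proof.
set q := (1 - p^-1)^-1.
have q_gt0 : 0 < q by rewrite invr_gt0 subr_gt0 invf_lt1.
have pq : p^-1 + q^-1 = 1 by rewrite /q invrK addrC subrK.
pose F1 z := phi z * k x z `^ p^-1.
pose F2 z := k x z `^ q^-1.
have mF1 : measurable_fun setT F1.
  apply: measurable_funM => //; exact: (measurableT_comp (measurable_powR _) (mk x)).
have mF2 : measurable_fun setT F2 by exact: (measurableT_comp (measurable_powR _) (mk x)).
have := hoelder mu mF1 mF2 p_gt0 q_gt0 pq.
rewrite Lnorm1.
have -> : (\int[mu]_z `|(EFin \o (F1 \* F2)%R) z| = gauss_average c U g phi x)%E.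
  apply: eq_integral => z _ /=.
  rewrite /F1 /F2 -mulrA -powRD ?pq ?oner_eq0// powRr1//.
  by rewrite ger0_norm// mulr_ge0.
move=> /le_trans; apply; rewrite unlock.
have -> : (\int[mu]_z (`|(EFin \o F1) z| `^ p) = J x)%E.
  apply: eq_integral => z _ /=.
  rewrite ger0_norm ?mulr_ge0 ?powR_ge0// /F1 powRM ?powR_ge0//.
  by rewrite -powRrM mulVf// powRr1.
have -> : (\int[mu]_z (`|(EFin \o F2) z| `^ q) = G%:E)%E.
  rewrite /G -(integral_gauss_kernel (U *m x + g) c_gt0).
  apply: eq_integral => z _ /=.
  by rewrite ger0_norm ?powR_ge0// /F2 -powRrM mulVf ?gt_eqF// powRr1.
by rewrite poweR_EFin /q invrK.
Qed.

Variables (m n : nat) (A : R) (F : 'cV[R]_d -> 'M[R]_(m, n)).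
Hypotheses (A_ge0 : 0 <= A) (mF : measurable_fun setT F)
  (F_le : forall x, ((enorm (F x))%:E <= A%:E * gauss_average c U g phi x)%E).
Hypothesis phi_fin : (Lnorm mu p%:E (fun z => (phi z)%:E) < +oo)%E.

Let enorm_ge0 x : 0 <= enorm (F x). Proof. exact: sqrtr_ge0. Qed.

Let LnormE : Lnorm mu p%:E (fun z => (phi z)%:E) = (Ip `^ p^-1)%E.
Proof.
rewrite unlock (eq_integral (fun z => (phi z `^ p)%:E)) => [//|z _ /=].
by rewrite (ger0_norm (phi_ge0 z)).
Qed.

Let Ip_ge0 : (0 <= Ip)%E.
Proof. by apply: integral_ge0 => z _; rewrite lee_fin powR_ge0. Qed.

Let Ip_fin : Ip \is a fin_num.
Proof.
rewrite ge0_fin_numE//; have := phi_fin; rewrite LnormE.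
by apply: lty_poweRy; rewrite invr_neq0.
Qed.

Let I := fine Ip.
Let I_ge0 : 0 <= I. Proof. exact: fine_ge0. Qed.
Let IpE : Ip = I%:E. Proof. by rewrite fineK. Qed.
Let j x := fine (J x).
Let J_fin x : J x \is a fin_num.
Proof. by rewrite ge0_fin_numE// (le_lt_trans (J_le x))// IpE ltry. Qed.
Let jE x : J x = (j x)%:E. Proof. by rewrite fineK. Qed.
Let j_ge0 x : 0 <= j x. Proof. by rewrite fine_ge0. Qed.
Let j_le x : j x <= I. Proof. by rewrite -lee_fin -jE -IpE. Qed.

Let B := A * G `^ (1 - p^-1).
Let B_ge0 : 0 <= B. Proof. by rewrite mulr_ge0// powR_ge0. Qed.

Let enorm_le_j x : enorm (F x) <= B * j x `^ p^-1.
Proof.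
rewrite -lee_fin (le_trans (F_le x))//.
rewrite (le_trans (lee_wpmul2l _ (smoothing_hoelder x)))//.
by rewrite jE poweR_EFin -!EFinM lee_fin /B; apply: eq_ler; ring.
Qed.

Let p_inv_ge0 : 0 <= p^-1. Proof. by rewrite invr_ge0 ltW. Qed.

Let Linfty_bound x : enorm (F x) <= B * I `^ p^-1.
Proof.
have jI : j x `^ p^-1 <= I `^ p^-1 by rewrite ge0_ler_powR// nnegrE.
exact: (le_trans (enorm_le_j x) (ler_wpM2l B_ge0 jI)).
Qed.

Let Lq_bound (q : R) : p <= q ->
  (Lpnorm q%:E F <=
   (B * gauss_mass d (c / L) `^ q^-1 * I `^ p^-1)%:E)%E.
Proof.
move=> pq; have q_gt0 : 0 < q by exact: lt_le_trans pq.
have GL0 : 0 < gauss_mass d (c / L) by rewrite gauss_mass_gt0// divr_gt0.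
have pointwise x : enorm (F x) `^ q <= B `^ q * I `^ (q / p - 1) * j x.
  apply: (@le_trans _ _ ((B * j x `^ p^-1) `^ q)).
    by rewrite ge0_ler_powR ?nnegrE ?mulr_ge0 ?powR_ge0// ltW.
  rewrite powRM ?powR_ge0// -mulrA ler_wpM2l ?powR_ge0// -powRrM (mulrC _ q).
  have -> : j x `^ (q / p) = j x `^ (q / p - 1) * j x.
    by rewrite [RHS]mulrC mulr_powRB1 ?divr_gt0.
  apply: ler_wpM2r; first exact: j_ge0.
  by rewrite ge0_ler_powR ?nnegrE// subr_ge0 ler_pdivlMr// mul1r.
have menorm : measurable_fun setT (fun x => enorm (F x)) by exact: measurable_enorm.
have int_le : (\int[mu]_x (`|(enorm (F x))%:E| `^ q) <=
    ((B * I `^ p^-1) `^ q * gauss_mass d (c / L))%:E)%E.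
  apply: (@le_trans _ _ (\int[mu]_x ((B `^ q * I `^ (q / p - 1))%:E * J x)))%E.
    apply: ge0_le_integral.
    - exact: measurableT.
    - by move=> x _; exact: poweR_ge0.
    - under eq_fun do rewrite /= ger0_norm//.
      apply/measurable_EFinP.
      exact: (measurableT_comp (measurable_powR _) menorm).
    - by apply: emeasurable_funM => //; exact: measurable_cst.
    - by move=> x _; rewrite /= ger0_norm// jE -EFinM lee_fin.
  rewrite ge0_integralZl//; last by rewrite lee_fin mulr_ge0// powR_ge0.
  apply: (le_trans (lee_wpmul2l _ int_J)).
    by rewrite lee_fin mulr_ge0// powR_ge0.
  rewrite IpE -!EFinM lee_fin; apply: eq_ler.
  rewrite powRM ?powR_ge0// -powRrM (mulrC _ q).
  by rewrite -(@mulr_powRB1 _ I (q / p)) ?divr_gt0//; ring.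
rewrite /Lpnorm unlock.
apply: (@le_trans _ _ (((B * I `^ p^-1) `^ q * gauss_mass d (c / L))%:E `^ q^-1)%E).
  apply: gt0_ler_poweR.
  + by rewrite invr_ge0 ltW.
  + rewrite in_itv/= leey andbT.
    by apply: integral_ge0 => x _; rewrite lee_fin powR_ge0.
  + by rewrite in_itv/= leey andbT lee_fin mulr_ge0 ?powR_ge0// ltW.
  + exact: int_le.
rewrite poweR_EFin lee_fin powRM ?powR_ge0// ?(ltW GL0)//.
rewrite -powRrM mulfV ?gt_eqF// powRr1 ?mulr_ge0 ?powR_ge0//.
by apply: eq_ler; ring.
Qed.

Let gauss_massZ : gauss_mass d (c / L) = Num.sqrt L ^+ d * G.
Proof.
rewrite /G /gauss_mass -exprMn -sqrtrM ?ltW//; congr (Num.sqrt _ ^+ _).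
by field; rewrite !gt_eqF.
Qed.

(** The [L^infty] bound and the [L^p] bound both follow from Hoelder's
    inequality, and [|F| ^ q <= sup |F| ^ (q - p) * |F| ^ p] interpolates
    between them. *)
Lemma gaussian_smoothing (q : \bar R) : (p%:E <= q)%E ->
  (Lpnorm q F <=
   (A * (Num.sqrt L ^+ d) `^ fine (q^-1)%E *
    gauss_mass d c `^ (1 - (p^-1 - fine (q^-1)%E)))%:E *
   Lnorm mu p%:E (fun z => (phi z)%:E))%E.
Proof.
have Lnorm_I : Lnorm mu p%:E (fun z => (phi z)%:E) = (I `^ p^-1)%:E.
  by rewrite LnormE IpE poweR_EFin.
rewrite Lnorm_I -EFinM; case: q => [q|_|]; last by rewrite leNgt ltNyr.
- rewrite lee_fin => pq; have q0 : q != 0 by rewrite gt_eqF// (lt_le_trans p_gt0).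
  apply: (le_trans (Lq_bound pq)); rewrite lee_fin.
  rewrite inver (negbTE q0)/= gauss_massZ powRM ?exprn_ge0 ?sqrtr_ge0 ?(ltW G_gt0)//.
  have -> : gauss_mass d c `^ (1 - (p^-1 - q^-1)) = G `^ (1 - p^-1) * G `^ q^-1.
    by rewrite -powRD ?(gt_eqF G_gt0) ?implybT// opprB addrA addrAC.
  have regroup (b1 b2 b3 b4 b5 : R) :
    b1 * b2 * (b3 * b4) * b5 = b1 * b3 * (b2 * b4) * b5 by ring.
  by apply: eq_ler; exact: regroup.
- rewrite invey/= powRr0 mulr1 subr0.
  rewrite /Lpnorm unlock; case: ifPn => _; last first.
    by rewrite lee_fin mulr_ge0 ?powR_ge0.
  apply/ess_supP; apply: aeW => x /=.
  rewrite lee_fin (ger0_norm (enorm_ge0 x)); exact: Linfty_bound.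
Qed.

End gaussian_smoothing.

(** * Mehler's formula: kernel bounds and differentiation *)

Lemma measurable_Rintegral (R : realType) d1 d2 (T1 : measurableType d1)
    (T2 : measurableType d2) (m : {sigma_finite_measure set T2 -> \bar R})
    (h : T1 * T2 -> R) : measurable_fun setT h ->
  measurable_fun setT (fun x => \int[m]_z h (x, z)).
Proof.
move=> mh; have mEh : measurable_fun setT (EFin \o h) by exact/measurable_EFinP.
have -> : (fun x => \int[m]_z h (x, z)) = (fun x =>
    fine (\int[m]_z (EFin \o h)^\+ (x, z) - \int[m]_z (EFin \o h)^\- (x, z))%E).
  apply/funext => x; rewrite /Rintegral integralE; congr (fine (_ - _)%E).
  - by apply: eq_integral => z _; rewrite !funeposE.
  - by apply: eq_integral => z _; rewrite !funenegE.
apply: measurableT_comp => //; apply: emeasurable_funB.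
- apply: (measurable_fun_fubini_tonelli_F (m2 := m) (EFin \o h)^\+%E).
  + exact: measurable_funepos.
  + by move=> z; exact: funepos_ge0.
- apply: (measurable_fun_fubini_tonelli_F (m2 := m) (EFin \o h)^\-%E).
  + exact: measurable_funeneg.
  + by move=> z; exact: funeneg_ge0.
Qed.

Lemma is_derive_expR_quadratic (R : realType) (v a b e h : R) :
  is_derive h 1 (fun h : R => v * expR (a + b * h + e * h ^+ 2))
    (v * ((b + 2 * e * h) * expR (a + b * h + e * h ^+ 2))).
Proof.
have D1 : is_derive h 1 (fun h : R => a + b * h + e * h ^+ 2) (b + 2 * e * h).
  apply: is_derive_eq.
  by rewrite !(scaler0, add0r, addr0, expr1, derive_val, derive_cst) /GRing.scale/=; ring.
have D2 := @is_derive1_comp _ expR (fun h : R => a + b * h + e * h ^+ 2) h _ _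
  (is_derive_expR (a + b * h + e * h ^+ 2)) D1.
have D3 := is_deriveZ v D2.
apply: is_derive_eq; rewrite /GRing.scale/=; ring.
Qed.

Section entry_bounds.
Context {R : realType} {m n : nat}.
Implicit Types A : 'M[R]_(m, n).

Lemma enorm_ge0 A : 0 <= enorm A. Proof. exact: sqrtr_ge0. Qed.

Lemma entry_le_enorm A i j : `|A i j| <= enorm A.
Proof.
rewrite -sqrtr_sqr ler_wsqrtr// (bigD1 i)//= (bigD1 j)//= -addrA lerDl.
by rewrite addr_ge0// sumr_ge0// => *; rewrite ?sumr_ge0// => *; exact: sqr_ge0.
Qed.

Lemma enorm_le_entries A b : 0 <= b -> (forall i j, `|A i j| <= b) ->
  enorm A <= (m * n)%:R * b.
Proof.
move=> b0 Ab; have sqr_le : \sum_i \sum_j A i j ^+ 2 <= (m * n)%:R * b ^+ 2.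
  apply: (@le_trans _ _ (\sum_(i < m) \sum_(j < n) b ^+ 2)).
    apply: ler_sum => i _; apply: ler_sum => j _.
    by rewrite -real_normK ?num_real// lerXn2r ?nnegrE.
  by rewrite !sumr_const !card_ord -mulrnA mulnC mulr_natl.
rewrite /enorm -[leRHS]ger0_norm ?mulr_ge0// -sqrtr_sqr.
apply: ler_wsqrtr; apply: (le_trans sqr_le); rewrite exprMn ler_wpM2r ?sqr_ge0//.
by rewrite -natrX ler_nat; case: (m * n)%N => // N; rewrite -{1}(expn1 N.+1) leq_pexp2l.
Qed.

End entry_bounds.

Lemma cvg_mulmx_diff_quotient (R : realType) d (k : R) (W : 'M[R]_d)
    (a : R -> 'I_d -> R) (b D : 'I_d -> R) (F : R -> 'cV[R]_d) (F0 : 'cV[R]_d) :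
  (forall h, F h = k *: (W *m \col_i a h i)) -> F0 = k *: (W *m \col_i b i) ->
  (forall i, h^-1 *: (a h i - b i) @[h --> 0^'] --> D i) ->
  h^-1 *: (F h - F0) @[h --> 0^'] --> (k *: (W *m \col_i D i) : 'cV[R]_d).
Proof.
move=> FE -> aD; apply: cvg_mx_entry => i j.
rewrite (_ : (fun h => _) = fun h => k * \sum_o W i o * (h^-1 * (a h o - b o))).
  rewrite !mxE; apply: cvgM; first exact: cvg_cst.
  apply: cvg_big => [|o _]; first by move=> z; exact: add_continuous.
  by apply: cvgM; [exact: cvg_cst|rewrite mxE; exact: aD].
apply/funext => h; rewrite FE !mxE -mulrBr mulrCA; congr (_ * _).
rewrite -sumrB mulr_sumr; apply: eq_bigr => o _.
by rewrite !mxE -mulrBr mulrCA.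
Qed.

(** [U] and [W] stand for the evolution matrices forwards and backwards in time,
    [P] for the inverse of the covariance matrix [evolQ], and [kap] for the
    normalizing constant. *)
Section mehler.
Context {R : realType} {d : nat}.
Local Notation mu := (lebesgue_cV R d).
Variables (U W P : 'M[R]_d) (g : 'cV[R]_d) (kap Lam l Ku Kw : R).
Hypotheses (Lam_gt0 : 0 < Lam) (l_gt0 : 0 < l) (Ku_ge0 : 0 <= Ku)
  (Kw_ge0 : 0 <= Kw) (P_sym : P^T = P)
  (P_ge : forall y, dotv y y <= Lam * dotv (P *m y) y)
  (P_bound : opbound P (l ^- 2))
  (U_bound : opbound U (Ku ^+ 2)) (W_entry : forall i k, `|W i k| <= Kw).
Variables (p : R) (u : 'cV[R]_d -> 'cV[R]_d).
Hypotheses (p_gt1 : 1 < p) (u_Lp : in_Lp p%:E u).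

Let phi z := enorm (u z).
Let p_gt0 : 0 < p. Proof. exact: lt_trans p_gt1. Qed.
Let m_u : measurable_fun setT u. Proof. by case: u_Lp. Qed.
Let mphi : measurable_fun setT phi. Proof. exact: measurable_enorm. Qed.
Let phi_ge0 z : 0 <= phi z. Proof. exact: enorm_ge0. Qed.
Let u_le_phi i z : `|u z i 0| <= phi z. Proof. exact: entry_le_enorm. Qed.

(** Half of the exponent [(4 * Lam)^-1] that [P_ge] gives for the weight; the
    other half absorbs the linear factor produced by differentiation. *)
Let gam : R := (8 * Lam)^-1.
Let gam_gt0 : 0 < gam. Proof. by rewrite invr_gt0 mulr_gt0. Qed.

Definition mehler_weight (y : 'cV[R]_d) : R := expR (- 4^-1 * dotv (P *m y) y).

Let quadratic_form_ge y : 4^-1 * dotv (P *m y) y >= 2 * gam * dotv y y.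
Proof.
rewrite /gam (_ : 2 * _ = (4 * Lam)^-1); last by field; rewrite gt_eqF.
rewrite mulrC ler_pdivrMr ?mulr_gt0//.
by rewrite (_ : 4^-1 * _ * _ = Lam * dotv (P *m y) y) ?P_ge//; field.
Qed.

Let weight_le y : mehler_weight y <= expR (- gam * dotv y y).
Proof.
rewrite ler_expR !mulNr lerN2 (le_trans _ (quadratic_form_ge y))//.
by rewrite ler_wpM2r ?dotvv_ge0// ler_peMl ?(ltW gam_gt0)// ler1n.
Qed.

Let slope : R := Ku / l * Num.sqrt (8 * Lam).
Let slope_ge0 : 0 <= slope.
Proof. by rewrite mulr_ge0 ?sqrtr_ge0// divr_ge0// ltW. Qed.

(** The linear factor produced by differentiation is absorbed by half of the
    Gaussian, because [x <= expR (x ^+ 2)]. *)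
Let slope_weight_le y w : dotv w w <= Ku ^+ 2 ->
  `|dotv (P *m y) w| * mehler_weight y <= slope * expR (- gam * dotv y y).
Proof.
move=> wKu; set r := Num.sqrt (dotv y y).
have r0 : 0 <= r by exact: sqrtr_ge0.
have r2 : r ^+ 2 = dotv y y by rewrite sqr_sqrtr ?dotvv_ge0.
have lin : `|dotv (P *m y) w| <= Ku / l * r.
  rewrite -(@ler_pXn2r _ 2)// ?nnegrE ?mulr_ge0 ?invr_ge0 ?(ltW l_gt0)//.
  rewrite real_normK ?num_real// (le_trans (cauchy_schwarz _ _))//.
  rewrite exprMn exprMn exprVn r2 (mulrC (Ku ^+ 2)) mulrAC.
  by rewrite ler_pM ?dotvv_ge0//; exact: P_bound.
set s := Num.sqrt (8 * Lam).
have s0 : 0 < s by rewrite sqrtr_gt0 mulr_gt0.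
have rs : r <= s * expR (gam * dotv y y).
  have t2 : (r / s) ^+ 2 = gam * dotv y y.
    by rewrite exprMn r2 exprVn sqr_sqrtr ?mulr_ge0 ?(ltW Lam_gt0)// mulrC.
  rewrite mulrC -ler_pdivrMr// -t2 (le_trans _ (expR_ge1Dx _))//.
  by have := sqr_ge0 (r / s - 1); have := sqr_ge0 (r / s); nra.
apply: (@le_trans _ _ ((Ku / l * r) * expR (- (2 * gam * dotv y y)))).
  rewrite ler_pM ?expR_ge0// ler_expR mulNr lerN2.
  exact: quadratic_form_ge.
rewrite /slope -!mulrA ler_wpM2l// ler_wpM2l ?invr_ge0 ?(ltW l_gt0)//.
apply: (le_trans (ler_wpM2r (expR_ge0 _) rs)).
rewrite -mulrA ler_wpM2l ?(ltW s0)// -expRD; apply: eq_ler; congr expR; ring.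
Qed.

Let smoothed := gauss_average gam U g phi.

(** [phi <= phi `^ p + 1] and the kernel is both bounded and integrable. *)
Let integrable_phi_gauss c w : 0 < c ->
  mu.-integrable setT (fun z => (phi z * gauss_kernel c w z)%:E).
Proof.
move=> c0.
have intk : mu.-integrable setT (fun z => (gauss_kernel c w z)%:E).
  apply/integrableP; split.
    by apply/measurable_EFinP; exact: measurable_gauss_kernel.
  under eq_integral do rewrite /= ger0_norm ?gauss_kernel_ge0//.
  by rewrite integral_gauss_kernel// ltry.
have intp : mu.-integrable setT (fun z => (phi z `^ p)%:E).
  apply/integrableP; split.
    by apply/measurable_EFinP; exact: (measurableT_comp (measurable_powR _) mphi).
  have [_] := u_Lp; rewrite /Lpnorm unlock => /lty_poweRy.
  rewrite invr_neq0 ?gt_eqF// => /(_ isT).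
  rewrite [X in (X < _)%E -> _](_ : _ = \int[mu]_z `|(phi z `^ p)%:E|)%E//.
  apply: eq_integral => z _ /=; by rewrite !ger0_norm ?powR_ge0 ?enorm_ge0.
apply: (le_integrable measurableT _ _ (integrableD measurableT intp intk)).
  apply/measurable_EFinP; apply: measurable_funM => //.
  exact: measurable_gauss_kernel.
move=> z _ /=; rewrite lee_fin !ger0_norm ?mulr_ge0 ?addr_ge0 ?gauss_kernel_ge0 ?powR_ge0//.
have [phi1|phi1] := leP (phi z) 1.
  rewrite (@le_trans _ _ (gauss_kernel c w z))//.
    by rewrite ler_piMl// gauss_kernel_ge0.
  by rewrite lerDr powR_ge0.
rewrite (@le_trans _ _ (phi z))//.
  by rewrite ler_piMr// gauss_kernel_le1// ltW.
by rewrite ler_wpDr ?gauss_kernel_ge0// le1r_powR// ltW.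
Qed.

Let norm_Rintegral_le x (h : 'cV[R]_d -> R) (C : R) :
  0 <= C -> measurable_fun setT h ->
  (forall z, `|h z| <= C * (phi z * gauss_kernel gam (U *m x + g) z)) ->
  (`|\int[mu]_z h z|%:E <= C%:E * smoothed x)%E.
Proof.
move=> C0 mh hC.
have intg := integrable_phi_gauss (U *m x + g) gam_gt0.
have inth : mu.-integrable setT (EFin \o h).
  apply: (le_integrable measurableT _ _ (integrableZl measurableT C intg)).
    exact/measurable_EFinP.
  move=> z _ /=; rewrite lee_fin (ger0_norm (x := C * _))//.
  by rewrite !mulr_ge0// gauss_kernel_ge0.
rewrite EFin_normr_Rintegral// (le_trans (le_abse_integral _ _ _))//.
  exact/measurable_EFinP.
rewrite /smoothed /gauss_average -ge0_integralZl//; first last.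
- by move=> z _; rewrite lee_fin mulr_ge0// gauss_kernel_ge0.
- apply/measurable_EFinP; apply: measurable_funM => //.
  exact: measurable_gauss_kernel.
apply: ge0_le_integral => //.
- by apply: measurableT_comp => //; exact/measurable_EFinP.
- apply/measurable_EFinP; apply: measurable_funM => //; apply: measurable_funM => //.
  exact: measurable_gauss_kernel.
- by move=> z _; rewrite -EFinM /= lee_fin.
Qed.

(** The evolution operator at fixed times, with the matrices and the constant
    that occur in it as parameters; the classical name for this form of the
    Ornstein-Uhlenbeck semigroup is Mehler's formula. *)
Definition mehler x : 'cV[R]_d := kap *: (W *m \col_i \int[mu]_y
  (u (U *m x + g - y) i 0 * expR (- 4^-1 * dotv (P *m y) y))).

Let H i x := \int[mu]_z (u z i 0 * mehler_weight (U *m x + g - z)).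

Lemma measurable_mehler_weight disp (T : measurableType disp) (F : T -> 'cV[R]_d) :
  measurable_fun setT F -> measurable_fun setT (fun x => mehler_weight (F x)).
Proof.
move=> mF; rewrite /mehler_weight; apply: measurableT_comp => //; apply: measurable_funM => //.
by apply: measurable_dotv => //; exact: measurable_mulmxl.
Qed.

Let mu_entry i : measurable_fun setT (fun z => u z i 0).
Proof. exact: (measurable_fun_mxP _).1. Qed.

Let m_arg x : measurable_fun setT (fun z : 'cV[R]_d => U *m x + g - z).
Proof. by apply: measurable_mxD => //; apply: measurable_mxN; exact: measurable_id. Qed.

Let m_arg2 : measurable_fun setT (fun xz : 'cV[R]_d * 'cV[R]_d => U *m xz.1 + g - xz.2).
Proof.
apply: measurable_mxD; last by apply: measurable_mxN; exact: measurable_snd.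
by apply: measurable_mxD => //; apply: measurable_mulmxl; exact: measurable_fst.
Qed.

(** The substitution [z = U *m x + g - y] moves the dependence on [x] from the
    merely measurable [u] into the smooth Gaussian. *)
Lemma mehlerE x : mehler x = kap *: (W *m \col_i H i x).
Proof.
rewrite /mehler; congr (_ *: (_ *m _)); apply/colP => i; rewrite 2!mxE /H.
rewrite -[RHS](Rintegral_cV_reflect (U *m x + g)).
  by apply: eq_Rintegral => y _; rewrite subKr.
apply: measurable_funM => //.
exact: measurable_mehler_weight.
Qed.

Let H_le i x : (`|H i x|%:E <= 1%:E * smoothed x)%E.
Proof.
apply: norm_Rintegral_le => //.
  by apply: measurable_funM => //; exact: measurable_mehler_weight.
move=> z; rewrite mul1r normrM ler_pM// ger0_norm ?expR_ge0//.
Qed.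

Let mH i : measurable_fun setT (H i).
Proof.
apply: (@measurable_Rintegral _ _ _ _ _ mu
  (fun xz => u xz.2 i 0 * mehler_weight (U *m xz.1 + g - xz.2))).
apply: measurable_funM; last exact: measurable_mehler_weight.
exact: (measurableT_comp (mu_entry i) measurable_snd).
Qed.

Lemma measurable_mehler : measurable_fun setT mehler.
Proof.
apply/measurable_fun_mxP => i j.
under eq_fun do rewrite mehlerE 2!mxE.
apply: measurable_funM => //; apply: measurable_sum => k; apply: measurable_funM => //.
by under eq_fun do rewrite mxE; exact: mH.
Qed.

Let DH i j x := \int[mu]_z (u z i 0 *
  (- 2^-1 * dotv (P *m (U *m x + g - z)) (U *m basisv j) *
   mehler_weight (U *m x + g - z))).

Let U_basis_le j : dotv (U *m basisv j) (U *m basisv j : 'cV[R]_d) <= Ku ^+ 2.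
Proof.
by have := U_bound (basisv j); rewrite dotv_basisv mulr1.
Qed.

Let DH_le i j x : (`|DH i j x|%:E <= (2^-1 * slope)%:E * smoothed x)%E.
Proof.
apply: norm_Rintegral_le.
- by rewrite mulr_ge0.
- apply: measurable_funM => //; apply: measurable_funM; last exact: measurable_mehler_weight.
  apply: measurable_funM => //; apply: measurable_dotv => //; exact: measurable_mulmxl.
- move=> z; set y := U *m x + g - z.
  have sw := slope_weight_le y (U_basis_le j).
  rewrite !normrM normrN (ger0_norm (x := 2^-1))// (ger0_norm (x := mehler_weight y)) ?expR_ge0//.
  apply: (@le_trans _ _ (phi z * (2^-1 * (slope * expR (- gam * dotv y y))))); last first.
    by rewrite /gauss_kernel -/y; apply: eq_ler; ring.
  by rewrite -[2^-1 * _ * _]mulrA ler_pM ?mulr_ge0 ?expR_ge0// ler_wpM2l.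
Qed.

Let mDH i j : measurable_fun setT (DH i j).
Proof.
apply: (@measurable_Rintegral _ _ _ _ _ mu (fun xz => u xz.2 i 0 *
    (- 2^-1 * dotv (P *m (U *m xz.1 + g - xz.2)) (U *m basisv j) *
     mehler_weight (U *m xz.1 + g - xz.2)))).
apply: measurable_funM.
  exact: (measurableT_comp (mu_entry i) measurable_snd).
apply: measurable_funM; last exact: measurable_mehler_weight.
by apply: measurable_funM => //; apply: measurable_dotv => //; exact: measurable_mulmxl.
Qed.

Let line_derive (v h : R) (y w : 'cV[R]_d) :
  is_derive h 1 (fun h : R => v * mehler_weight (y + h *: w))
    (v * (- 2^-1 * dotv (P *m (y + h *: w)) w * mehler_weight (y + h *: w))).
Proof.
pose a := - 4^-1 * dotv (P *m y) y; pose b := - 2^-1 * dotv (P *m y) w.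
pose e := - 4^-1 * dotv (P *m w) w.
have PC : dotv (P *m w) y = dotv (P *m y) w by rewrite dotv_mull P_sym dotvC.
have weightE k : mehler_weight (y + k *: w) = expR (a + b * k + e * k ^+ 2).
  rewrite /mehler_weight mulmxDr -scalemxAr !(dotvDl, dotvDr, dotvZl, dotvZr) PC.
  by congr expR; rewrite /a /b /e; field.
have -> : - 2^-1 * dotv (P *m (y + h *: w)) w = b + 2 * e * h.
  by rewrite mulmxDr -scalemxAr dotvDl dotvZl /b /e; field.
rewrite (_ : (fun h => _) = (fun h => v * expR (a + b * h + e * h ^+ 2))).
  by rewrite weightE; exact: is_derive_expR_quadratic.
by apply/funext => k; rewrite weightE.
Qed.

(** Moving the centre by at most [w] costs a constant factor and half of the
    exponent: this provides the dominating function, independent of the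
    increment [h], for differentiation under the integral. *)
Let weight_shift_le h (y w : 'cV[R]_d) : `|h| <= 1 -> dotv w w <= Ku ^+ 2 ->
  expR (- gam * dotv (y + h *: w) (y + h *: w)) <=
  expR (gam * Ku ^+ 2) * expR (- (gam / 2) * dotv y y).
Proof.
move=> h1 wKu; rewrite -expRD ler_expR.
have h2 : h ^+ 2 <= 1 by rewrite -real_normK ?num_real// expr_le1.
have par : dotv y y <= 2 * dotv (y + h *: w) (y + h *: w) + 2 * (h ^+ 2 * dotv w w).
  have := dotvv_ge0 (y + (2 * h) *: w).
  by rewrite !(dotvDl, dotvDr, dotvZl, dotvZr) (dotvC w y) => ?; lra.
have hw : h ^+ 2 * dotv w w <= Ku ^+ 2.
  by rewrite (le_trans _ wKu)// ler_piMl ?dotvv_ge0.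
rewrite -subr_ge0 (_ : _ - _ = gam * (Ku ^+ 2 - dotv y y / 2 +
  dotv (y + h *: w) (y + h *: w))); last by field.
by rewrite mulr_ge0 ?(ltW gam_gt0)//; lra.
Qed.

Let H_derive_cvg i j x :
  h^-1 *: (H i (h *: basisv j + x) - H i x) @[h --> 0^'] --> DH i j x.
Proof.
set w := U *m basisv j.
pose y z := U *m x + g - z.
pose f (h : R) z := u z i 0 * mehler_weight (y z + h *: w).
have HE h : H i (h *: basisv j + x) = \int[mu]_z f h z.
  apply: eq_Rintegral => z _; rewrite /f /y /w; congr (_ * mehler_weight _).
  by rewrite mulmxDr -scalemxAr -!addrA [LHS]addrC -!addrA.
have mline h : measurable_fun setT (fun z => y z + h *: w).
  by apply: measurable_mxD => //; exact: m_arg.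
have mf h : measurable_fun setT (f h).
  by apply: measurable_funM => //; exact: measurable_mehler_weight.
have intf (h : R) : `]-1, 1[%classic h -> mu.-integrable setT (EFin \o f h).
  move=> _; apply: (le_integrable measurableT _ _
      (integrable_phi_gauss (U *m x + g + h *: w) gam_gt0)).
    exact/measurable_EFinP.
  move=> z _ /=; rewrite lee_fin normrM.
  rewrite [leRHS]ger0_norm ?mulr_ge0 ?gauss_kernel_ge0//.
  rewrite ler_pM// (ger0_norm (x := mehler_weight _)) ?expR_ge0//.
  by rewrite /gauss_kernel (addrAC _ (h *: w)) weight_le.
have derf h z : `]-1, 1[%classic h -> setT z -> derivable (f ^~ z) h 1.
  by move=> _ _; case: (line_derive (u z i 0) h (y z) w).
have d1f h z : partial1of2 f h z =
    u z i 0 * (- 2^-1 * dotv (P *m (y z + h *: w)) w * mehler_weight (y z + h *: w)).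
  by rewrite partial1of2E; case: (line_derive (u z i 0) h (y z) w).
pose C := 2^-1 * slope * expR (gam * Ku ^+ 2).
have C0 : 0 <= C by rewrite mulr_ge0 ?expR_ge0// mulr_ge0.
have gam2 : 0 < gam / 2 by rewrite divr_gt0.
pose B z := C * (phi z * gauss_kernel (gam / 2) (U *m x + g) z).
have B0 z : 0 <= B z by apply: mulr_ge0 => //; rewrite mulr_ge0 ?gauss_kernel_ge0.
have intB : mu.-integrable setT (EFin \o B).
  exact: (integrableZl measurableT C (integrable_phi_gauss (U *m x + g) gam2)).
have f_le h z : `]-1, 1[%classic h -> setT z -> `|partial1of2 f h z| <= B z.
  rewrite /= in_itv/= => /andP[h1 h2] _; rewrite d1f.
  have hn : `|h| <= 1 by rewrite ler_norml !ltW.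
  have sw := slope_weight_le (y z + h *: w) (U_basis_le j).
  rewrite !normrM normrN (ger0_norm (x := 2^-1))// (ger0_norm (x := mehler_weight _)) ?expR_ge0//.
  apply: (@le_trans _ _ (phi z * (2^-1 * (slope *
      (expR (gam * Ku ^+ 2) * expR (- (gam / 2) * dotv (y z) (y z))))))); last first.
    by rewrite /B /C /gauss_kernel -/(y z); apply: eq_ler; ring.
  rewrite -[2^-1 * _ * _]mulrA ler_pM ?mulr_ge0 ?expR_ge0// ler_wpM2l//.
  apply: (le_trans sw); rewrite ler_wpM2l//.
  by apply: weight_shift_le => //; exact: U_basis_le.
have I0 : `]-1, 1[%classic (0 : R) by rewrite /= in_itv/= ltrN10 ltr01.
have := cvg_differentiation_under_integral measurableT I0 intf derf B0 intB f_le.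
rewrite (_ : \int[mu]_z partial1of2 f 0 z = DH i j x); last first.
  by apply: eq_Rintegral => z _; rewrite d1f scale0r addr0.
have H0 : \int[mu]_z f 0 z = H i x.
  by apply: eq_Rintegral => z _; rewrite /f scale0r addr0.
rewrite H0 => cv; apply: cvg_trans cv; apply: near_eq_cvg; apply: nearW => h.
by rewrite addr0 (HE h).
Qed.

Let mehler_derive_cvg j x :
  h^-1 *: (mehler (h *: basisv j + x) - mehler x) @[h --> 0^'] -->
  (kap *: (W *m \col_i DH i j x) : 'cV[R]_d).
Proof.
apply: (@cvg_mulmx_diff_quotient _ _ kap W (fun h o => H o (h *: basisv j + x))
  (fun o => H o x)) => [h||o].
- exact: mehlerE.
- exact: mehlerE.
- exact: H_derive_cvg.
Qed.

Lemma has_gradient_mehler : has_gradient mehler.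
Proof. by move=> x j; apply/cvg_ex; eexists; exact: mehler_derive_cvg. Qed.

Let gradient_mehlerE x : gradient mehler x =
  \matrix_(i, j) (kap *: (W *m \col_k DH k j x)) i 0.
Proof.
apply/matrixP => i j; rewrite !mxE; have /cvg_lim := @mehler_derive_cvg j x.
by rewrite /derive => -> //; rewrite !mxE.
Qed.

Lemma measurable_gradient_mehler : measurable_fun setT (gradient mehler).
Proof.
apply/measurable_fun_mxP => i j.
under eq_fun do rewrite gradient_mehlerE 3!mxE.
apply: measurable_funM => //; apply: measurable_sum => k; apply: measurable_funM => //.
by under eq_fun do rewrite mxE; exact: mDH.
Qed.

Let smoothed_fin x : smoothed x \is a fin_num.
Proof. exact: integrable_fin_num (integrable_phi_gauss _ gam_gt0). Qed.

Let smoothed_ge0 x : (0 <= smoothed x)%E.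
Proof.
by apply: integral_ge0 => z _; rewrite lee_fin mulr_ge0// gauss_kernel_ge0.
Qed.

Let combination_le (D : 'I_d -> R) C x i : 0 <= C ->
  (forall k, (`|D k|%:E <= C%:E * smoothed x)%E) ->
  `|(kap *: (W *m \col_k D k)) i 0| <= `|kap| * (d%:R * (Kw * (C * fine (smoothed x)))).
Proof.
move=> C0 DC; rewrite 2!mxE normrM ler_wpM2l// (le_trans (ler_norm_sum _ _ _))//.
apply: (@le_trans _ _ (\sum_(k < d) Kw * (C * fine (smoothed x)))).
  apply: ler_sum => k _; rewrite mxE normrM ler_pM//.
  by rewrite -lee_fin EFinM fineK.
by rewrite sumr_const card_ord mulr_natl.
Qed.

Lemma enorm_mehler_le x : ((enorm (mehler x))%:E <=
  ((d ^ 2)%:R * `|kap| * Kw)%:E * smoothed x)%E.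
Proof.
rewrite -(fineK (smoothed_fin x)) -EFinM lee_fin.
apply: (@le_trans _ _ ((d * 1)%:R * (`|kap| * (d%:R * (Kw * (1 * fine (smoothed x))))))).
  apply: enorm_le_entries.
    by rewrite !mulr_ge0 ?fine_ge0.
  move=> i j; rewrite ord1 mehlerE; apply: combination_le => // k; exact: H_le.
by rewrite muln1 natrX; apply: eq_ler; ring.
Qed.

Lemma enorm_gradient_mehler_le x : ((enorm (gradient mehler x))%:E <=
  ((d ^ 3)%:R * `|kap| * Kw * (2^-1 * slope))%:E * smoothed x)%E.
Proof.
rewrite -(fineK (smoothed_fin x)) -EFinM lee_fin.
apply: (@le_trans _ _ ((d * d)%:R *
    (`|kap| * (d%:R * (Kw * (2^-1 * slope * fine (smoothed x))))))).
  apply: enorm_le_entries.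
    by rewrite 3?mulr_ge0// mulr_ge0 ?fine_ge0// mulr_ge0.
  move=> i j; rewrite gradient_mehlerE mxE; apply: combination_le => [|k].
    by rewrite mulr_ge0.
  exact: DH_le.
by rewrite natrM natrX; apply: eq_ler; ring.
Qed.

End mehler.

(** * The evolution matrices and the covariance matrix *)

Lemma Rintegral_sum (R : realType) disp (T : measurableType disp)
    (m : {measure set T -> \bar R}) (D : set T) (I : finType) (h : I -> T -> R) :
  measurable D -> (forall i, m.-integrable D (EFin \o h i)) ->
  \int[m]_(x in D) (\sum_i h i x) = \sum_i \int[m]_(x in D) h i x.
Proof.
move=> mD inth; rewrite /Rintegral; under eq_integral do rewrite -sumEFin.
rewrite (integral_sum mD inth) sum_fine// => i _.
exact: (integrable_fin_num mD (inth i)).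
Qed.

Section evolution_family.
Context {R : realType} {d : nat}.
Local Notation mu := (@lebesgue_measure R).
Implicit Types (M : R -> 'M[R]_d).

Lemma integral_abC (a b : R) (h : R -> R) : integral_ab a b h = - integral_ab b a h.
Proof.
rewrite /integral_ab; have [ab|ba|->] := ltgtP a b.
- by rewrite opprK.
- by [].
- by rewrite set_itv1 Rintegral_set1 oppr0.
Qed.

Lemma mx_integral_abC m n (a b : R) (F : R -> 'M[R]_(m, n)) :
  mx_integral_ab a b F = - mx_integral_ab b a F.
Proof. by apply/matrixP => i j; rewrite !mxE integral_abC. Qed.

Lemma evolU_mulC M t s : evolU M t s *m evolU M s t = 1%:M.
Proof. by rewrite /evolU (mx_integral_abC t s) expmx_mulN. Qed.

Lemma opbound_expmx_skew (A : 'M[R]_d) : A^T = - A -> opbound (expmx A) 1.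
Proof.
move=> skewA v; rewrite dotv_mull mulmxA trmx_expmx skewA.
by rewrite -{2}(opprK A) expmx_mulN mul1mx mul1r.
Qed.

Lemma measurable_expmx_entry (D : set R) (A : R -> 'M[R]_d) : measurable D ->
  (forall i j, measurable_fun D (fun r => A r i j)) ->
  forall i j, measurable_fun D (fun r => expmx (A r) i j).
Proof.
move=> mD mA i j.
have mpow k : forall i j, measurable_fun D (fun r => (A r ^+ k) i j).
  elim: k => [|k IHk] i' j'.
    by under eq_fun do rewrite expr0; exact: measurable_cst.
  under eq_fun do rewrite exprS mxE.
  by apply: measurable_sum => l; exact: measurable_funM.
apply: (@measurable_fun_cvg _ _ _ _ (fun n r => series (expmx_term (A r) i j) n)).
  move=> n; under eq_fun do rewrite seriesEord/=.
  by apply: measurable_sum => k; exact: measurable_funM.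
by move=> r Dr; exact: expmx_cvg.
Qed.

(** [evolQ] is the integral of the matrices [W r = U U^T], with [U] the
    evolution matrix from [s] to [r]. Each of their quadratic forms lies
    between [L^-1] and [L] times the square of the norm, and integration
    over an interval of length [t - s] gives the bounds for [evolQ]. *)
Section gram.
Variables (s t L : R) (M : R -> 'M[R]_d).
Hypotheses (st : s < t) (L_gt0 : 0 < L)
  (mU : forall i j, measurable_fun `[s, t] (fun r => evolU M r s i j))
  (bU : forall r, s <= r <= t -> opbound (evolU M r s) L)
  (bV : forall r, s <= r <= t -> opbound (evolU M s r) L).

Let W r := evolU M r s *m (evolU M r s)^T.

Let mst : measurable (`[s, t]%classic : set (measurableTypeR R)).
Proof. exact: measurable_itv. Qed.

Let mu_st : (mu `[s, t]%classic = (t - s)%:E)%E.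
Proof. by rewrite lebesgue_measure_itv/= lte_fin st EFinB. Qed.

Let integrable_bounded (h : R -> R) (C : R) : measurable_fun `[s, t] h ->
  (forall r, s <= r <= t -> `|h r| <= C) -> mu.-integrable `[s, t] (EFin \o h).
Proof.
move=> mh hC; apply: measurable_bounded_integrable => //.
  by have := ltry (t - s); rewrite -mu_st.
exists C; split; first exact: num_real.
move=> C' CC' r/=; rewrite in_itv/= => /hC /le_trans; apply; exact: ltW.
Qed.

Let mW i j : measurable_fun `[s, t] (fun r => W r i j).
Proof.
rewrite /W; under [X in measurable_fun _ X]eq_fun do rewrite mxE.
apply: measurable_sum => k; apply: measurable_funM => //.
by under [X in measurable_fun _ X]eq_fun do rewrite mxE; exact: mU.
Qed.

Let intW i j : mu.-integrable `[s, t] (EFin \o (fun r => W r i j)).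
Proof.
apply: (@integrable_bounded _ (d%:R * L)) => // r srt.
rewrite mxE (le_trans (ler_norm_sum _ _ _))//.
apply: (@le_trans _ _ (\sum_(k < d) L)); last by rewrite sumr_const card_ord mulr_natl.
apply: ler_sum => k _; rewrite mxE normrM -(sqr_sqrtr (ltW L_gt0)) expr2.
by rewrite ler_pM// opbound_entry ?(ltW L_gt0)//; exact: bU.
Qed.

Lemma evolQ_sym : (evolQ M t s)^T = evolQ M t s.
Proof.
apply/matrixP => i j; rewrite !mxE /integral_ab (ltW st); apply: eq_Rintegral => r _.
have symW : (W r)^T = W r by rewrite /W trmx_mul trmxK.
by rewrite -[RHS]/(W r i j) -[in RHS]symW [RHS]mxE.
Qed.

Let W_ge v r : s <= r <= t -> L^-1 * dotv v v <= dotv (W r *m v) v.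
Proof.
move=> srt; rewrite /W -mulmxA dotv_mull mulrC ler_pdivrMr// mulrC.
apply: (opbound_inv_ge _ (opbound_tr (ltW L_gt0) (bV srt))).
by rewrite -trmx_mul evolU_mulC trmx1.
Qed.

Let W_le v r : s <= r <= t -> dotv (W r *m v) v <= L * dotv v v.
Proof.
move=> srt; rewrite /W -mulmxA dotv_mull.
exact: (opbound_tr (ltW L_gt0) (bU srt)).
Qed.

Let evolQ_form v : dotv (evolQ M t s *m v) v = \int[mu]_(r in `[s, t]) dotv (W r *m v) v.
Proof.
have formE (A : 'M[R]_d) : dotv (A *m v) v =
    \sum_(ij : 'I_d * 'I_d) A ij.1 ij.2 * (v ij.2 0 * v ij.1 0).
  rewrite -(pair_bigA _ (fun i j => A i j * (v j 0 * v i 0))).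
  apply: eq_bigr => i _; rewrite mxE mulr_suml; apply: eq_bigr => j _.
  by rewrite mulrA.
rewrite formE; under [RHS]eq_Rintegral do rewrite formE.
rewrite Rintegral_sum//; last first.
  move=> ij; apply: eq_integrable (integrableZr mst (v ij.2 0 * v ij.1 0)
    (intW ij.1 ij.2)) => //.
apply: eq_bigr => ij _; rewrite RintegralZr//; congr (_ * _).
by rewrite mxE /integral_ab (ltW st).
Qed.

Let integrable_form v : mu.-integrable `[s, t] (EFin \o (fun r => dotv (W r *m v) v)).
Proof.
apply: (@integrable_bounded _ (L * dotv v v)) => [|r srt].
  apply: measurable_sum => i; apply: measurable_funM => //.
  under [X in measurable_fun _ X]eq_fun do rewrite mxE.
  by apply: measurable_sum => j; apply: measurable_funM.
rewrite ger0_norm ?W_le// (le_trans _ (W_ge v srt))// mulr_ge0 ?dotvv_ge0//.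
by rewrite invr_ge0 ltW.
Qed.

Let Rintegral_cst_st (k : R) : \int[mu]_(r in `[s, t]) k = (t - s) * k.
Proof. by rewrite Rintegral_cst// -[X in fine X]/(mu `[s, t]%classic) mu_st mulrC. Qed.

Let integrable_cst_st (k : R) : mu.-integrable `[s, t] (EFin \o (fun _ => k)).
Proof. by apply: (@integrable_bounded _ `|k|). Qed.

Lemma evolQ_ge v : (t - s) / L * dotv v v <= dotv (evolQ M t s *m v) v.
Proof.
rewrite evolQ_form -mulrA -Rintegral_cst_st; apply: le_Rintegral => //.
by move=> r; rewrite /= in_itv/=; exact: W_ge.
Qed.

Lemma evolQ_le v : dotv (evolQ M t s *m v) v <= (t - s) * L * dotv v v.
Proof.
rewrite evolQ_form -mulrA -Rintegral_cst_st; apply: le_Rintegral => //.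
by move=> r; rewrite /= in_itv/=; exact: W_le.
Qed.

End gram.
End evolution_family.

(** * The estimate with constants depending on the evolution matrices *)

Section evolV_estimate.
Context {R : realType} {d : nat}.
Variables (p : R) (q : \bar R) (L : R).
Hypotheses (p_gt1 : 1 < p) (p_le_q : (p%:E <= q)%E) (L_gt0 : 0 < L).

Let iq : R := fine (q^-1)%E.
Let th : R := p^-1 - iq.
Let e : R := - (d%:R / 2) * th.

Let half_pow (a : R) : 0 < a -> Num.sqrt a ^+ d = a `^ (d%:R / 2).
Proof.
move=> a0; rewrite -powR12_sqrt ?(ltW a0)// -powR_mulrn ?powR_ge0// -powRrM.
by rewrite mulrC.
Qed.

Let scaling (a : R) : 0 < a ->
  Num.sqrt a ^- d * (Num.sqrt a ^+ d) `^ (1 - th) = a `^ e.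
Proof.
move=> a0; rewrite half_pow// -powRN -powRrM -powRD; last by rewrite (gt_eqF a0) implybT.
by congr (_ `^ _); rewrite /e; ring.
Qed.

Let kap0 : R := ((4 * pi) `^ (d%:R / 2))^-1 * (Num.sqrt d`!%:R * Num.sqrt L ^+ d).
Let mass0 : R := (Num.sqrt L ^+ d) `^ iq * (Num.sqrt (8 * pi * L) ^+ d) `^ (1 - th).
Let C0 : R := (d ^ 2)%:R * kap0 * Num.sqrt L * mass0.
Let C1 : R := (d ^ 3)%:R * kap0 * Num.sqrt L *
  (2^-1 * (Num.sqrt L * L * Num.sqrt (8 * L))) * mass0.

Let kap0_ge0 : 0 <= kap0.
Proof. by rewrite mulr_ge0 ?invr_ge0 ?powR_ge0// mulr_ge0 ?exprn_ge0 ?sqrtr_ge0. Qed.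

Let mass0_ge0 : 0 <= mass0. Proof. by rewrite mulr_ge0 ?powR_ge0. Qed.

Let C0_ge0 : 0 <= C0.
Proof. by rewrite mulr_ge0// mulr_ge0 ?sqrtr_ge0// mulr_ge0. Qed.

Let C1_ge0 : 0 <= C1.
Proof.
rewrite mulr_ge0// mulr_ge0//; last by rewrite !mulr_ge0 ?sqrtr_ge0// ltW.
by rewrite mulr_ge0 ?sqrtr_ge0// mulr_ge0.
Qed.

Section fixed_times.
Variables (M : R -> 'M[R]_d) (f : R -> 'cV[R]_d) (s t : R) (u : 'cV[R]_d -> 'cV[R]_d).
Hypotheses (u_Lp : in_Lp p%:E u) (st : s < t)
  (mU : forall i j, measurable_fun `[s, t] (fun r => evolU M r s i j))
  (bU : forall r, s <= r <= t -> opbound (evolU M r s) L)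
  (bV : forall r, s <= r <= t -> opbound (evolU M s r) L).

Let a := t - s.
Let a_gt0 : 0 < a. Proof. by rewrite subr_gt0. Qed.
Let U := evolU M t s.
Let W := evolU M s t.
Let g := evolg M f t s.
Let Q := evolQ M t s.
Let P := invmx Q.
Let Lam := a * L.
Let l := a / L.
Let kap := ((4 * pi) `^ (d%:R / 2) * Num.sqrt (\det Q))^-1.

Let st_t : s <= t <= t. Proof. by rewrite (ltW st) lexx. Qed.
Let Lam_gt0 : 0 < Lam. Proof. by rewrite mulr_gt0. Qed.
Let l_gt0 : 0 < l. Proof. by rewrite divr_gt0. Qed.
Let Q_sym : Q^T = Q. Proof. exact: evolQ_sym. Qed.
Let Q_ge v : l * dotv v v <= dotv (Q *m v) v. Proof. exact: evolQ_ge. Qed.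
Let Q_le v : dotv (Q *m v) v <= Lam * dotv v v. Proof. exact: evolQ_le. Qed.
Let P_sym : P^T = P. Proof. exact: invmx_sym. Qed.
Let P_ge y : dotv y y <= Lam * dotv (P *m y) y.
Proof. exact: (invmx_form_ge l_gt0 Q_sym Q_ge Q_le). Qed.
Let P_bound : opbound P (l ^- 2).
Proof. exact: (opbound_invmx l_gt0 Q_sym Q_ge). Qed.
Let sqrtL2 : Num.sqrt L ^+ 2 = L. Proof. by rewrite sqr_sqrtr// ltW. Qed.
Let U_bound : opbound U (Num.sqrt L ^+ 2).
Proof. by rewrite sqrtL2; exact: bU. Qed.
Let W_entry i k : `|W i k| <= Num.sqrt L.
Proof. by apply: opbound_entry (bV st_t); exact: ltW. Qed.
Let U_unit : U \in unitmx.
Proof. exact: (mulmx1_unit (evolU_mulC M t s)).1. Qed.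
Let U_ge v : dotv v v <= L * dotv (U *m v) (U *m v).
Proof. exact: (opbound_inv_ge (evolU_mulC M s t) (bV st_t)). Qed.

Let kap_le : `|kap| <= kap0 * Num.sqrt a ^- d.
Proof.
have four_pi : 0 <= ((4 * pi) `^ (d%:R / 2))^-1 :> R by rewrite invr_ge0 powR_ge0.
rewrite ger0_norm; last by rewrite invr_ge0 mulr_ge0 ?powR_ge0 ?sqrtr_ge0.
rewrite /kap invfM /kap0 -mulrA ler_wpM2l//.
apply: (le_trans (inv_sqrt_det_le l_gt0 Q_sym Q_ge)).
rewrite sqrtrM// -mulrA ler_wpM2l ?sqrtr_ge0//.
rewrite -exprVn /l invf_div; apply: eq_ler.
have -> : Num.sqrt ((L / a) ^+ d) = Num.sqrt (L / a) ^+ d.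
  elim: (d) => [|n IHn]; first by rewrite !expr0 sqrtr1.
  by rewrite !exprS sqrtrM ?IHn// ltW// divr_gt0.
by rewrite sqrtrM ?(ltW L_gt0)// exprMn sqrtrV ?(ltW a_gt0)// exprVn.
Qed.

Let massE : gauss_mass d (8 * Lam)^-1 =
  Num.sqrt (8 * pi * L) ^+ d * Num.sqrt a ^+ d.
Proof.
rewrite /gauss_mass invrK -exprMn -sqrtrM; last first.
  by rewrite !mulr_ge0 ?pi_ge0// ltW.
by congr (Num.sqrt _ ^+ _); rewrite /Lam; ring.
Qed.

Let smoothed := gauss_average (8 * Lam)^-1 U g (fun z => enorm (u z)).

Let smoothed_ge0 x : (0 <= smoothed x)%E.
Proof.
by apply: integral_ge0 => z _; rewrite lee_fin mulr_ge0 ?enorm_ge0 ?gauss_kernel_ge0.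
Qed.

Let Lq_estimate m n (F : 'cV[R]_d -> 'M[R]_(m, n)) A : 0 <= A ->
  measurable_fun setT F ->
  (forall x, ((enorm (F x))%:E <= (A * Num.sqrt a ^- d)%:E * smoothed x)%E) ->
  in_Lp q F /\ (Lpnorm q F <= (A * mass0 * a `^ e)%:E * Lpnorm p%:E u)%E.
Proof.
move=> A0 mF Fle; have [m_u u_fin] := u_Lp.
have c0 : 0 < (8 * Lam)^-1 by rewrite invr_gt0 mulr_gt0.
have A0' : 0 <= A * Num.sqrt a ^- d by rewrite mulr_ge0// invr_ge0 exprn_ge0 ?sqrtr_ge0.
have := gaussian_smoothing c0 L_gt0 U_unit U_ge p_gt1
  (measurable_enorm m_u) (fun x => enorm_ge0 (u x)) A0' mF Fle u_fin p_le_q.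
rewrite -/(Lpnorm p%:E u) massE powRM ?exprn_ge0 ?sqrtr_ge0//.
rewrite (_ : _ * _ * _ * _ = A * mass0 * a `^ e); last first.
  have regroup (b1 b2 b3 b4 b5 : R) :
    b1 * b2 * b3 * (b4 * b5) = b1 * (b3 * b4) * (b2 * b5) by ring.
  by rewrite -scaling//; exact: regroup.
move=> Fq; split=> //; split=> //.
by rewrite (le_lt_trans Fq)// lte_mul_pinfty// lee_fin !mulr_ge0 ?powR_ge0.
Qed.

Lemma evolV_estimate_fixed :
  [/\ in_Lp q (evolV M f t s u),
      (Lpnorm q (evolV M f t s u) <=
       ((C0 + C1 + 1) * (t - s) `^ e)%:E * Lpnorm p%:E u)%E,
      has_gradient (evolV M f t s u),
      in_Lp q (gradient (evolV M f t s u)) &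
      (Lpnorm q (gradient (evolV M f t s u)) <=
       ((C0 + C1 + 1) * (t - s) `^ (e - 2^-1))%:E * Lpnorm p%:E u)%E].
Proof.
have -> : evolV M f t s u = mehler U W P g kap u by rewrite /evolV gt_eqF.
have sL := sqrtr_ge0 L.
have kap_scaled (B : R) : 0 <= B ->
    B * `|kap| * Num.sqrt L <= B * kap0 * Num.sqrt L * Num.sqrt a ^- d.
  move=> B0; rewrite mulrAC (_ : B * kap0 * _ * _ =
    B * Num.sqrt L * (kap0 * Num.sqrt a ^- d)); last by ring.
  by rewrite ler_wpM2l// mulr_ge0.
have u0 : (0 <= Lpnorm p%:E u)%E by exact: Lnorm_ge0.
have [V_in V_le] : in_Lp q (mehler U W P g kap u) /\
    (Lpnorm q (mehler U W P g kap u) <= (C0 * a `^ e)%:E * Lpnorm p%:E u)%E.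
  apply: (@Lq_estimate _ _ _ ((d ^ 2)%:R * kap0 * Num.sqrt L)).
  - by rewrite mulr_ge0// mulr_ge0.
  - exact: (measurable_mehler _ _ _ _ _ u_Lp).
  - move=> x; apply: (le_trans (enorm_mehler_le U g kap Lam_gt0 sL P_ge W_entry p_gt1 u_Lp x)).
    by apply: lee_wpmul2r; [exact: smoothed_ge0|rewrite lee_fin kap_scaled].
have slopeE : Num.sqrt L / l * Num.sqrt (8 * Lam) =
    Num.sqrt L * L * Num.sqrt (8 * L) * (Num.sqrt a)^-1.
  have ra0 : Num.sqrt a != 0 by rewrite gt_eqF// sqrtr_gt0.
  have a2 : a = Num.sqrt a ^+ 2 by rewrite sqr_sqrtr// ltW.
  have aV : a^-1 * Num.sqrt a = (Num.sqrt a)^-1 by rewrite {1}a2; field.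
  rewrite /Lam /l invf_div (_ : 8 * (a * L) = 8 * L * a); last by ring.
  rewrite sqrtrM ?mulr_ge0 ?(ltW L_gt0)// -aV; ring.
have [G_in G_le] : in_Lp q (gradient (mehler U W P g kap u)) /\
    (Lpnorm q (gradient (mehler U W P g kap u)) <=
     (C1 * a `^ (e - 2^-1))%:E * Lpnorm p%:E u)%E.
  have -> : C1 * a `^ (e - 2^-1) = ((d ^ 3)%:R * kap0 * Num.sqrt L *
      (2^-1 * (Num.sqrt L * L * Num.sqrt (8 * L))) * (Num.sqrt a)^-1) * mass0 * a `^ e.
    rewrite powRD; last by rewrite (gt_eqF a_gt0) implybT.
    by rewrite powRN powR12_sqrt ?(ltW a_gt0)// /C1; ring.
  apply: Lq_estimate.
  - rewrite mulr_ge0 ?invr_ge0 ?sqrtr_ge0// mulr_ge0//; first by rewrite mulr_ge0// mulr_ge0.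
    by rewrite !mulr_ge0 ?sqrtr_ge0// ltW.
  - exact: (measurable_gradient_mehler W g kap Lam_gt0 l_gt0 sL
      P_sym P_ge P_bound U_bound p_gt1 u_Lp).
  - move=> x; apply: (le_trans (enorm_gradient_mehler_le g kap Lam_gt0 l_gt0 sL sL
      P_sym P_ge P_bound U_bound W_entry p_gt1 u_Lp x)).
    apply: lee_wpmul2r; first exact: smoothed_ge0.
    rewrite lee_fin slopeE.
    set K := Num.sqrt L * L * Num.sqrt (8 * L).
    have K0 : 0 <= 2^-1 * (K / Num.sqrt a).
      by rewrite mulr_ge0// divr_ge0 ?sqrtr_ge0// mulr_ge0 ?sqrtr_ge0// mulr_ge0// ltW.
    have d3 : 0 <= (d ^ 3)%:R :> R by [].
    apply: (le_trans (ler_wpM2r K0 (kap_scaled _ d3))).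
    by apply: eq_ler; ring.
have CM C k : 0 <= C -> C <= C0 + C1 + 1 ->
    ((C * a `^ k)%:E * Lpnorm p%:E u <= ((C0 + C1 + 1) * a `^ k)%:E * Lpnorm p%:E u)%E.
  by move=> ? ?; apply: lee_wpmul2r => //; rewrite lee_fin ler_wpM2r ?powR_ge0.
split=> //.
- by apply: (le_trans V_le); apply: CM => //; rewrite -addrA lerDl addr_ge0.
- exact: (has_gradient_mehler Lam_gt0 l_gt0 sL P_sym P_ge P_bound U_bound p_gt1 u_Lp).
- by apply: (le_trans G_le); apply: CM => //; rewrite addrAC lerDr addr_ge0.
Qed.

End fixed_times.

(** Where the power of [t - s] comes from: the normalizing constant is of order
    [(t - s) `^ (- d / 2)], the Gaussian has mass of order [(t - s) `^ (d / 2)],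
    which enters with the exponent [1 - (p^-1 - q^-1)], and a derivative of
    the Gaussian costs [(t - s) `^ (- 1 / 2)]. All constants depend on the
    evolution matrices only through [L]. *)
Lemma evolV_estimate : exists2 C : R, 0 < C &
  forall (M : R -> 'M[R]_d) (f : R -> 'cV[R]_d) (s t : R) (u : 'cV[R]_d -> 'cV[R]_d),
  in_Lp p%:E u -> s < t ->
  (forall i j, measurable_fun `[s, t] (fun r => evolU M r s i j)) ->
  (forall r, s <= r <= t -> opbound (evolU M r s) L) ->
  (forall r, s <= r <= t -> opbound (evolU M s r) L) ->
  [/\ in_Lp q (evolV M f t s u),
      (Lpnorm q (evolV M f t s u) <= (C * (t - s) `^ e)%:E * Lpnorm p%:E u)%E,
      has_gradient (evolV M f t s u),
      in_Lp q (gradient (evolV M f t s u)) &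
      (Lpnorm q (gradient (evolV M f t s u)) <=
       (C * (t - s) `^ (e - 2^-1))%:E * Lpnorm p%:E u)%E].
Proof.
exists (C0 + C1 + 1); first by rewrite ltr_wpDl ?addr_ge0.
by move=> *; exact: evolV_estimate_fixed.
Qed.

End evolV_estimate.

(** * Continuous generators *)

Section continuous_generator.
Context {R : realType} {d : nat}.
Local Notation mu := (@lebesgue_measure R).
Variable M : R -> 'M[R]_d.
Hypothesis M_cont : {within `[0, +oo[, continuous M}.

Let Mij_cont (a b : R) i j : 0 <= a -> {within `[a, b], continuous (fun r => M r i j)}.
Proof.
move=> a0; have Mab : {within `[a, b], continuous M}.
  apply: continuous_subspaceW M_cont => r /=; rewrite !in_itv/= andbT => /andP[ar _].
  exact: le_trans ar.
move=> r; apply: (@cvg_comp _ _ _ (M : subspace `[a, b] -> _)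
  (fun A : 'M[R]_d => A i j) _ _ _ (Mab r)).
exact: coord_continuous.
Qed.

Let Mij_int (a b : R) i j : 0 <= a ->
  mu.-integrable `[a, b] (EFin \o (fun r => M r i j)).
Proof.
by move=> a0; apply: continuous_compact_integrable;
  [exact: segment_compact|exact: Mij_cont].
Qed.

Lemma measurable_evolU (s t : R) (i j : 'I_d) : 0 <= s -> s < t ->
  measurable_fun `[s, t] (fun r => evolU M r s i j).
Proof.
move=> s0 st; apply: measurable_expmx_entry => // k l.
have mI : measurable_fun `[s, t] (fun r => \int[mu]_(x in `[s, r]) M x k l).
  apply: subspace_continuous_measurable_fun => //.
  apply: parameterized_integral_continuous; first exact: ltW.
  exact: Mij_int.
apply: eq_measurable_fun mI => r; rewrite inE/= in_itv/= => /andP[sr _].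
by rewrite mxE /integral_ab sr.
Qed.

(** A bound for the exponents [mx_integral_ab s r M] that is uniform in
    [0 <= s <= r <= T]. *)
Definition generator_mass (T : R) : R := \sum_i \sum_j \int[mu]_(x in `[0, T]) `|M x i j|.

Lemma sumnorm_mx_integral_le s r T : 0 <= s -> s <= r -> r <= T ->
  sumnorm (mx_integral_ab s r M) <= generator_mass T.
Proof.
move=> s0 sr rT; apply: ler_sum => i _; apply: ler_sum => j _.
rewrite mxE /integral_ab sr.
apply: (le_trans (le_normr_Rintegral _ _)) => //; first exact: Mij_int.
have intT := integrable_norm (Mij_int T i j (lexx 0)).
have ints := integrable_norm (Mij_int r i j s0).
rewrite /Rintegral fine_le ?integrable_fin_num//.
apply: ge0_subset_integral => //.
- by case/integrableP : intT.
- move=> x /=; rewrite !in_itv/= => /andP[sx xr].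
  by rewrite (le_trans s0 sx) (le_trans xr rT).
Qed.

Lemma opbound_evolU s r T : 0 <= s -> s <= r -> r <= T ->
  let L := ((d ^ 2)%:R * expR (generator_mass T)) ^+ 2 in
  opbound (evolU M r s) L /\ opbound (evolU M s r) L.
Proof.
move=> s0 sr rT L.
have expL (A : 'M[R]_d) : sumnorm A <= generator_mass T -> opbound (expmx A) L.
  move=> AN; apply: opbound_le (opbound_sumnorm (expmx A)).
  rewrite lerXn2r ?nnegrE ?sumnorm_ge0 ?mulr_ge0 ?expR_ge0//.
  by rewrite (le_trans (sumnorm_expmx A))// ler_wpM2l// ler_expR.
have N := sumnorm_mx_integral_le s0 sr rT.
split; first exact: expL N.
by rewrite /evolU mx_integral_abC; apply: expL; rewrite sumnormN.
Qed.

(** Skew-symmetric exponents have orthogonal exponentials, which is why the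
    constants are then uniform on the whole half-line. *)
Lemma opbound_evolU_skew s r : (forall t : R, 0 < t -> (M t)^T = - M t) ->
  0 <= s -> s <= r -> opbound (evolU M r s) 1 /\ opbound (evolU M s r) 1.
Proof.
move=> skewM s0 sr; set A := mx_integral_ab s r M.
have skewA : A^T = - A.
  apply/matrixP => i j; rewrite !mxE /integral_ab sr.
  (* At time 0 skew-symmetry is not given, so the left endpoint is removed. *)
  rewrite -(Rintegral_itv_obnd_cbnd (f := fun x => M x j i)); last first.
    apply: integrableS (Mij_int r j i s0) => //.
    by apply: subset_itvr; rewrite bnd_simp.
  rewrite -(Rintegral_itv_obnd_cbnd (f := fun x => M x i j)); last first.
    apply: integrableS (Mij_int r i j s0) => //.
    by apply: subset_itvr; rewrite bnd_simp.
  rewrite -mulN1r -RintegralZl//; last first.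
    apply: integrableS (Mij_int r i j s0) => //.
    by apply: subset_itvr; rewrite bnd_simp.
  apply: eq_Rintegral => x; rewrite inE/= in_itv/= => /andP[sx _].
  have := skewM x (le_lt_trans s0 sx) => /matrixP /(_ i j).
  by rewrite !mxE mulN1r.
split; first exact: opbound_expmx_skew.
rewrite /evolU mx_integral_abC; apply: opbound_expmx_skew.
by rewrite linearN/= skewA.
Qed.

End continuous_generator.

Theorem proposition3p3 (R : realType) (d : nat)
    (M : R -> 'M[R]_d) (f : R -> 'cV[R]_d)
    (M_cont : {within `[0, +oo[, continuous M})
    (f_cont : {within `[0, +oo[, continuous f})
    (M_comm : forall t s : R, 0 < t -> 0 < s -> M t *m M s = M s *m M t)
    (p : R) (q : \bar R) (p_gt1 : 1 < p) (p_le_q : (p%:E <= q)%E) :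
  let e : R := - (d%:R / 2) * (p^-1 - fine (q^-1)%E) in
  (forall T : R, 0 < T ->
   exists2 C : R, 0 < C &
   forall u, Lp_sigma p%:E u ->
   forall s t : R, 0 <= s -> s < t -> t <= T ->
     [/\ in_Lp q (evolV M f t s u),
         (Lpnorm q (evolV M f t s u)
          <= (C * (t - s) `^ e)%:E * Lpnorm p%:E u)%E,
         has_gradient (evolV M f t s u),
         in_Lp q (gradient (evolV M f t s u)) &
         (Lpnorm q (gradient (evolV M f t s u))
          <= (C * (t - s) `^ (e - 2^-1))%:E * Lpnorm p%:E u)%E])
  /\
  ((forall t : R, 0 < t -> (M t)^T = - M t) ->
   exists2 C : R, 0 < C &
   forall u, Lp_sigma p%:E u ->
   forall s t : R, 0 <= s -> s < t ->
     [/\ in_Lp q (evolV M f t s u),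
         (Lpnorm q (evolV M f t s u)
          <= (C * (t - s) `^ e)%:E * Lpnorm p%:E u)%E,
         has_gradient (evolV M f t s u),
         in_Lp q (gradient (evolV M f t s u)) &
         (Lpnorm q (gradient (evolV M f t s u))
          <= (C * (t - s) `^ (e - 2^-1))%:E * Lpnorm p%:E u)%E]).
Proof.
move=> e; split=> [T T_gt0|skewM].
- pose L := ((d ^ 2)%:R * expR (generator_mass M T)) ^+ 2 + 1.
  have L_gt0 : 0 < L by rewrite ltr_wpDl// sqr_ge0.
  have [C C_gt0 estC] := @evolV_estimate R d _ _ _ p_gt1 p_le_q L_gt0.
  exists C => // u [u_Lp _] s t s0 st tT.
  have bL r : s <= r <= t -> opbound (evolU M r s) L /\ opbound (evolU M s r) L.
    move=> /andP[sr rt].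
    have [bU bV] := opbound_evolU M_cont s0 sr (le_trans rt tT).
    have LL : ((d ^ 2)%:R * expR (generator_mass M T)) ^+ 2 <= L by rewrite lerDl.
    exact: (conj (opbound_le LL bU) (opbound_le LL bV)).
  apply: (estC M f s t u u_Lp st).
  + by move=> i j; exact: measurable_evolU.
  + by move=> r /bL[bU _]; exact: bU.
  + by move=> r /bL[_ bV]; exact: bV.
- have [C C_gt0 estC] := @evolV_estimate R d _ _ _ p_gt1 p_le_q (ltr01 : 0 < 1 :> R).
  exists C => // u [u_Lp _] s t s0 st.
  have b1 r : s <= r <= t -> opbound (evolU M r s) 1 /\ opbound (evolU M s r) 1.
    by move=> /andP[sr _]; exact: opbound_evolU_skew.
  apply: (estC M f s t u u_Lp st).
  + by move=> i j; exact: measurable_evolU.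
  + by move=> r /b1[bU _]; exact: bU.
  + by move=> r /b1[_ bV]; exact: bV.
Qed.
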